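(* Let $p(z)$ be a nonzero Hilbert polynomial, of degree $d$, of a graded quotient of $R=K[x_0,\ldots,x_n]$. Consider the following procedure. (1) Compute $\Delta^1p(z),\ldots,\Delta^dp(z)$, where $\Delta^dp(z)=c$ for some $c\in\mathbb{N}$. Set $\mathcal{S}^{(d)}=\cdots=\mathcal{S}^{(0)}=\varnothing$. (2) Let $\mathcal{S}^{(d)}$ be the set of all ideals of $R^{(d)}$ obtained from the ideal $(1)=R^{(d)}$ by $c$ successive expansions of monomial generators in $R^{(d)}$, exhausting all choices for $c$ successive expansions. (3) For $j=d-1,d-2,\ldots,0$, do the following for each ideal $I\in\mathcal{S}^{(j+1)}$: let $a=\Delta^jp(z)-p_{R^{(j)}/I\cdot R^{(j)}}(z)$. If $a\ge0$, add to $\mathcal{S}^{(j)}$ all ideals obtained from $I\cdot R^{(j)}$ by $a$ successive expansions of monomial generators in $R^{(j)}$, exhausting all choices for $a$ successive expansions. If $a<0$, continue with the next ideal of $\mathcal{S}^{(j+1)}$. (4) Return $\mathcal{S}^{(0)}$. This procedure terminates, and the returned set $\mathcal{S}^{(0)}$ is exactly the set of all saturated strongly stable ideals $I$ of $R$ such that $R/I$ has Hilbert polynomial $p(z)$.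
   Context: $K$ is an arbitrary field, $n\ge 2$, $R=K[x_0,\ldots,x_n]$, and $R^{(j)}=K[x_0,\ldots,x_{n-j}]$ (so $R^{(0)}=R$). $p_A$ denotes the Hilbert polynomial of a standard graded $K$-algebra $A$. $\Delta^0p(z)=p(z)$ and $\Delta^jp(z)=\Delta^{j-1}p(z)-\Delta^{j-1}p(z-1)$. A monomial ideal $I$ of a polynomial ring $K[x_0,\ldots,x_m]$ is strongly stable if for every monomial $x^A\in I$ and every $x_j\mid x^A$ we have $\frac{x_i}{x_j}x^A\in I$ whenever $0\le i<j$. A strongly stable ideal of $K[x_0,\ldots,x_m]$ is saturated iff no minimal monomial generator is divisible by $x_m$. $G(I)$ denotes the set of minimal monomial generators of $I$. For a monomial $x^A\ne1$, $\max(x^A)=\max\{i: x_i\mid x^A\}$. Expansion in $S=K[x_0,\ldots,x_m]$: for a monomial $x^A$ of positive degree put $\mathrm{Right}(x^A)=\{x^A\frac{x_{i+1}}{x_i}: x_i\mid x^A,\ 0\le i<m-1\}$. If $I\subsetneq S$ is a saturated strongly stable ideal and $x^A\neq 1$ lies in $G(I)$ with $G(I)\cap \mathrm{Right}(x^A)=\varnothing$, then $x^A$ is called expandable in $I$, and the expansion of $x^A$ in $I$ is the ideal generated by $(G(I)\setminus\{x^A\})\cup\{x^A x_r,x^Ax_{r+1},\ldots,x^Ax_{m-1}\}$, where $r=\max(x^A)$. If $I=S$ and $x^A=1$, the expansion of $1$ in $S$ is the ideal $(x_0,\ldots,x_{m-1})$. *)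

(* Defs.v *)
From mathcomp Require Import all_boot all_order all_algebra.
From mathcomp Require Import boolp classical_sets cardinality.
From mathcomp Require Import mpoly.

Set Implicit Arguments.
Unset Strict Implicit.
Unset Printing Implicit Defensive.

Import GRing.Theory.
Local Open Scope ring_scope.
Local Open Scope classical_set_scope.

(* Throughout, K[x_0, ..., x_m] is {mpoly K[m.+1]}, the monomial x^A is 'X_[A]
   with A : 'X_{1..m.+1}, and ideals are classical sets of polynomials. *)

Section Ideals.
Variables (K : fieldType) (m : nat).
Local Notation S := {mpoly K[m.+1]}.
Implicit Types I J : set S.

Definition is_ideal I : Prop :=
  [/\ I 0, forall f g, I f -> I g -> I (f + g) & forall f g, I g -> I (f * g)].

Definition ideal_gen (X : set S) : set S := smallest is_ideal X.

Definition ideal_mul I J : set S :=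
  ideal_gen [set h | exists f g, [/\ I f, J g & h = f * g]].

Definition ideal_pow I (k : nat) : set S := iter k (ideal_mul I) setT.

Definition irrelevant_ideal : set S := ideal_gen (range (fun i => 'X_i)).

Definition saturation I : set S :=
  [set f | exists k, forall g, ideal_pow irrelevant_ideal k g -> I (g * f)].

Definition saturated I : Prop := saturation I = I.

Definition homogeneous_ideal I : Prop :=
  is_ideal I /\ forall f k, I f -> I (pihomog mdeg k f).

Definition monomial_ideal I : Prop :=
  exists M : set 'X_{1..m.+1}, I = ideal_gen [set 'X_[A] | A in M].

Definition strongly_stable I : Prop :=
  monomial_ideal I /\
  forall (A : 'X_{1..m.+1}) (i j : 'I_m.+1),
    I 'X_[A] -> (0 < A j)%N -> (i < j)%N -> I 'X_[(A - U_(j) + U_(i))%MM].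

(* h is the dimension of the degree-k component of S / I; V is I_k. *)
Definition hilbert_function I (k h : nat) : Prop :=
  exists V : {vspace dhomog m.+1 K k},
    (forall f : dhomog m.+1 K k, f \in V <-> I f) /\
    (h + \dim V = \dim (fullv : {vspace dhomog m.+1 K k}))%N.

Definition hilbert_polynomial I (q : {poly rat}) : Prop :=
  exists N, forall k, (N <= k)%N ->
    exists2 h : nat, hilbert_function I k h & q.[k%:R] = h%:R.

(* G(I); [(B <= A)%MM] is divisibility of x^A by x^B. *)
Definition min_gens I : set 'X_{1..m.+1} :=
  [set A | I 'X_[A] /\ forall B, I 'X_[B] -> (B <= A)%MM -> B = A].

(* max(x^A), for A <> 0 *)
Definition max_var (A : 'X_{1..m.+1}) : nat := \max_(i < m.+1 | (0 < A i)%N) i.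

(* Here j stands for i+1 and the condition i < m - 1 reads j < m. *)
Definition right_shifts (A : 'X_{1..m.+1}) : set 'X_{1..m.+1} :=
  [set B | exists i j : 'I_m.+1,
     [/\ (0 < A i)%N, j = i.+1 :> nat, (j < m)%N & B = (A - U_(i) + U_(j))%MM]].

Definition expandable I (A : 'X_{1..m.+1}) : Prop :=
  A <> 0%MM /\ min_gens I A /\ min_gens I `&` right_shifts A = set0.

(* [expansion I A I'] : I' is the expansion of x^A in I. *)
Inductive expansion : set S -> 'X_{1..m.+1} -> set S -> Prop :=
| ExpansionOne :
    expansion setT 0%MM
      (ideal_gen [set 'X_i | i in [set i : 'I_m.+1 | (i < m)%N]])
| ExpansionProper I A :
    strongly_stable I -> saturated I -> I <> setT -> expandable I A ->
    expansion I A
      (ideal_gen [set 'X_[B] | B in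
         (min_gens I `\ A) `|`
         [set (A + U_(i))%MM | i in [set i : 'I_m.+1 | (max_var A <= i < m)%N]]]).

Fixpoint successive_expansions (a : nat) I : set (set S) :=
  if a is b.+1 then
    [set I' | exists J A, successive_expansions b I J /\ expansion J A I']
  else [set I].

(* Exhausting all choices for a successive expansions starting from I is a
   finite task: whenever fewer than a of them have been performed, only finitely
   many monomials can be chosen for the next one. *)
Definition finitely_many_choices (a : nat) I : Prop :=
  forall b J, (b < a)%N -> successive_expansions b I J ->
    finite_set [set A | exists I', expansion J A I'].

End Ideals.

(* The extension of an ideal of K[x_0, ..., x_m] to K[x_0, ..., x_m, x_{m+1}]. *)
Definition extend (K : fieldType) (m : nat) (I : set {mpoly K[m.+1]}) :
    set {mpoly K[m.+2]} :=
  ideal_gen [set mwiden f | f in I].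

Definition backward_diff (q : {poly rat}) : {poly rat} := q - (q \Po ('X - 1%:P)).

Definition Delta (j : nat) (q : {poly rat}) : {poly rat} := iter j backward_diff q.

Section Procedure.
Variables (K : fieldType) (n d : nat) (p : {poly rat}).

(* [discrepancy j I a] : a = Delta^j p - p_{S/I}, for I an ideal of S = R^(j);
   in particular the right-hand side is a constant integer. *)
Definition discrepancy (j m : nat) (I : set {mpoly K[m.+1]}) (a : int) : Prop :=
  exists2 q, hilbert_polynomial I q & Delta j p - q = (a%:~R)%:P.

(* The ideals put into S^(j) when S^(j+1) is T. *)
Definition lift_and_expand (j m : nat) (T : set (set {mpoly K[m.+1]})) :
    set (set {mpoly K[m.+2]}) :=
  [set I' | exists I (a : nat),
     [/\ T I, discrepancy j (extend I) a%:Z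
       & successive_expansions a (extend I) I']].

(* Big-step semantics of the procedure: [computes j m T] says that m = n - j, so
   that R^(j) = K[x_0, ..., x_m], and that the procedure completes the
   construction of S^(j), with result T.  For this, all the numbers c and a must
   be well defined, and all the exhaustive searches and loops finite. *)
Inductive computes : nat -> forall m, set (set {mpoly K[m.+1]}) -> Prop :=
| ComputesTop m (c : nat) :
    (m + d = n)%N -> Delta d p = (c%:R)%:P ->
    finitely_many_choices c [set: {mpoly K[m.+1]}] ->
    finite_set (successive_expansions c [set: {mpoly K[m.+1]}]) ->
    computes d (successive_expansions c [set: {mpoly K[m.+1]}])
| ComputesNext j m (T : set (set {mpoly K[m.+1]})) :
    computes j.+1 T ->
    (forall I, T I -> exists2 a : int, discrepancy j (extend I) a
       & forall b : nat, a = b%:Z -> finitely_many_choices b (extend I)) ->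
    finite_set (lift_and_expand j T) ->
    computes j (lift_and_expand j T).

(* The procedure terminates and returns S^(0) = T. *)
Definition returns (T : set (set {mpoly K[n.+1]})) : Prop := computes 0 T.

End Procedure.

(* Main.v *)
Require Import Defs.
From mathcomp Require Import all_boot all_order all_algebra.
From mathcomp Require Import boolp classical_sets cardinality.
From mathcomp Require Import mpoly zify ring lra.

(** A saturated strongly stable ideal of K[x_0, ..., x_m] is determined by its
    monomials in x_0, ..., x_(m-1), which form a set U closed under
    multiplication and under left shifts.  In these terms an expansion removes
    from U one monomial such that the rest is still stable, and it raises the
    Hilbert polynomial of the quotient by 1.  If U is contained in V with finite
    complement, then a monomial of V \ U of maximal weight
    \sum_i (m - i) A_i can be put back into U, so U is reached from V by
    |V \ U| expansions.

    For a saturated strongly stable ideal J of K[x_0, ..., x_(m+1)] whose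
    monomials in x_0, ..., x_m form the set W, the Hilbert function of the
    quotient by W is the first difference of that of the quotient by J.  Setting
    x_m = 1 in W gives the saturation of W, which by Dickson's lemma contains
    only finitely many more monomials and so has the same Hilbert polynomial.
    Hence J arises by finitely many expansions from the extension of an ideal
    that was found in the previous step. *)

Set Implicit Arguments.
Unset Strict Implicit.
Unset Printing Implicit Defensive.

Import GRing.Theory Num.Theory Order.TTheory.
Local Open Scope classical_set_scope.

(** * Stable sets of monomials *)

Section Monomials.
Variable n : nat.
Implicit Types (A B C : 'X_{1..n}) (U V W : set 'X_{1..n}).

Definition upset U := forall A B, U A -> (A <= B)%MM -> U B.

Definition shift_closed U := forall A (i j : 'I_n),
  U A -> 0 < A j -> i < j -> U (A - U_(j) + U_(i))%MM.

Definition stable U := upset U /\ shift_closed U.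

Definition minimal U A := U A /\ forall B, U B -> (B <= A)%MM -> B = A.

Lemma lem_anti A B : (A <= B)%MM -> (B <= A)%MM -> A = B.
Proof.
move=> /mnm_lepP AB /mnm_lepP BA; apply/mnmP => i.
by apply/eqP; rewrite eqn_leq AB BA.
Qed.

Lemma lem_mdeg A B : (A <= B)%MM -> mdeg A <= mdeg B.
Proof. by move=> /submK <-; rewrite mdegD leq_addl. Qed.

Lemma lem_mdeg_eq A B : (A <= B)%MM -> mdeg B <= mdeg A -> A = B.
Proof.
move=> /submK <-; rewrite mdegD => h.
have : mdeg (B - A)%MM == 0 by lia.
by rewrite mdeg_eq0 => /eqP ->; rewrite add0m.
Qed.

Lemma mnm_neq0P A : A <> 0%MM -> exists i, 0 < A i.
Proof.
move=> A0; apply: contrapT => h; apply: A0; apply/mnmP => i; rewrite mnm0E.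
by case E: (A i) => [//|k]; case: h; exists i; rewrite E.
Qed.

Lemma lem_neq A B : (A <= B)%MM -> A <> B -> exists i, (A + U_(i) <= B)%MM.
Proof.
move=> AB nAB; have [i hi] : exists i, 0 < (B - A)%MM i.
  by apply: mnm_neq0P => h; apply: nAB; rewrite -(submK AB) h add0m.
exists i; apply/mnm_lepP => j; have /mnm_lepP/(_ j) := AB.
move: hi; rewrite !mnmE; case: eqP => [<-|_] /=; lia.
Qed.

Lemma mnmB_add A i : 0 < A i -> (A - U_(i) + U_(i))%MM = A.
Proof. by move=> Ai; rewrite submK // lep1mP -lt0n. Qed.

Lemma upset_minimal U A : U A -> exists2 B, minimal U B & (B <= A)%MM.
Proof.
elim: {A}(mdeg A) {-2}A (leqnn (mdeg A)) => [|d IH] A hd UA.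
  have A0 : A = 0%MM by apply/eqP; rewrite -mdeg_eq0; lia.
  exists A; last exact: lepm_refl.
  split=> // B _ BA; apply: lem_mdeg_eq => //; lia.
have [m|/not_andP[//|]] := pselect (minimal U A); first by exists A; rewrite ?lepm_refl.
move=> /existsNP[B] /not_implyP[UB] /not_implyP[BA nBA].
have [|C mC CB] := IH B _ UB; last by exists C => //; apply: lepm_trans CB BA.
rewrite leqNgt; apply/negP => h; apply: nBA; apply: lem_mdeg_eq => //; lia.
Qed.

(** Removing [B] is harmful only if [B] is a multiple or a left shift of another element of [U].
    Adjacent shifts are enough to test: if [B] is the left shift of some [C] from [x_j] to [x_i],
    then shifting [C] only down to [x_(i+1)] gives the adjacent right shift of [B], which thus lies
    in [U], and minimality of [B] makes it minimal too. *)
Lemma removal_stable U B : stable U -> U B ->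
  (stable (U `\ B) <-> minimal U B /\
    forall i j : 'I_n, 0 < B i -> j = i.+1 :> nat ->
      ~ minimal U (B - U_(i) + U_(j))%MM).
Proof.
move=> [upU shU] UB; split.
  move=> [up' sh']; split.
    split=> // C UC CB; apply: contrapT => nCB.
    by have [_] := up' C B (conj UC nCB) CB; apply.
  move=> i j Bi ji [UD _].
  set D := (_ + _)%MM in UD.
  have ij : i != j by apply/eqP => h; move: ji; rewrite h; lia.
  have DB : (D - U_(j) + U_(i))%MM = B.
    apply/mnmP => k; rewrite /D !mnmE.
    by case: (i =P k) => [<-|_] /=; lia.
  have nDB : D <> B.
    by move=> /mnmP/(_ i); rewrite /D !mnmE eqxx eq_sym (negbTE ij) /=; lia.
  have [] := sh' D i j; [by split | | by rewrite ji | by move=> _; apply].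
  by rewrite /D !mnmE eqxx addn1.
move=> [[_ mB] noR]; split.
  move=> C D [UC nCB] CD; split; first exact: upU UC CD.
  by move=> DB; apply: nCB; apply: mB => //; rewrite -DB.
move=> C i j [UC nCB] Cj ij; split; first exact: shU.
move=> /= /esym BE.
have Bi : 0 < B i by rewrite BE !mnmE eqxx; lia.
have lti : i.+1 < n by apply: leq_ltn_trans (ltn_ord j).
pose l : 'I_n := Ordinal lti.
have il : i != l by apply/eqP => /(congr1 val) /=; lia.
apply: (noR i l) => //.
(* [D] is [B x_l / x_i] with [l = i + 1]. It is [C] itself if [l = j], and otherwise the left shift
   of [C] from [x_j] to [x_l]. *)
set D := (_ + _)%MM.
have UD : U D.
  have [e|ne] := eqVneq l j.
    suff -> : D = C by [].
    apply/mnmP => k; rewrite /D BE e !mnmE; rewrite e in il.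
    by case: (j =P k) Cj => [<-|_] /=; lia.
  have ltj : l < j by rewrite ltn_neqAle ne.
  suff -> : D = (C - U_(j) + U_(l))%MM by apply: shU.
  apply/mnmP => k; rewrite /D BE !mnmE; lia.
split=> // E UE ED.
apply: contrapT => nED.
have /mnm_lepP hED := ED.
have hD k : D k + (i == k) = B k + (l == k).
  rewrite /D !mnmE; case: (i =P k) => [<-|_] /=; lia.
(* A divisor [E] of [D] without [x_l] divides [B], so it equals [B], although its exponent at [i] is
   too small. Otherwise its shift from [x_l] to [x_i] divides [B], so it equals [B], which gives
   [E = D]. *)
have [E0|El] := posnP (E l).
  have EB : (E <= B)%MM.
    apply/mnm_lepP => k; have := hED k; have := hD k.
    by case: (l =P k) => [<-|_] /=; lia.
  have e := mB _ UE EB; move: (hED i) (hD i).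
  by rewrite e eqxx eq_sym (negbTE il) /=; lia.
have UE' := shU _ _ _ UE El (ltnSn i : i < l).
have E'B : (E - U_(l) + U_(i) <= B)%MM.
  apply/mnm_lepP => k; have := hED k; have := hD k; rewrite !mnmE.
  by case: (l =P k) => [<-|_] /=; lia.
have /mnmP e := mB _ UE' E'B; apply: nED; apply/mnmP => k.
move: (e k) (hD k) (hED k); rewrite !mnmE.
by case: (l =P k) => [<-|_] /=; lia.
Qed.

Definition weight A := \sum_(i < n) (n - i) * A i.

Lemma weightD A B : weight (A + B)%MM = weight A + weight B.
Proof. by rewrite -big_split; apply: eq_bigr => i _; rewrite mnmDE mulnDr. Qed.

Lemma weight1 (i : 'I_n) : weight U_(i)%MM = n - i.
Proof.
rewrite /weight (bigD1 i) //= mnm1E eqxx muln1 big1 ?addn0 // => j ne.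
by rewrite mnm1E eq_sym (negbTE ne) muln0.
Qed.

Lemma weight_lem A B : (A <= B)%MM -> A <> B -> weight A < weight B.
Proof.
move=> AB /(lem_neq AB)[i /submK <-].
by rewrite !weightD weight1; have := ltn_ord i; lia.
Qed.

Lemma weight_shift A (i j : 'I_n) :
  0 < A j -> i < j -> weight A < weight (A - U_(j) + U_(i))%MM.
Proof.
move=> Aj ij; rewrite -{1}(mnmB_add Aj) !weightD !weight1.
by have := ltn_ord j; lia.
Qed.

Lemma seq_max_weight (s : seq 'X_{1..n}) : s <> [::] ->
  exists2 A, A \in s & forall B, B \in s -> weight B <= weight A.
Proof.
elim: s => [//|A [_ _|B s IH]].
  by exists A; rewrite ?mem_head // => B; rewrite inE => /eqP ->.
have [//|C Cs hC _] := IH; have [h|h] := leqP (weight A) (weight C).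
  by exists C => [|D]; rewrite inE ?Cs ?orbT // => /orP[/eqP ->//|/hC].
exists A; rewrite ?mem_head // => D; rewrite inE => /orP[/eqP ->//|/hC].
by move=> /leq_trans; apply; apply: ltnW.
Qed.

(* Weight increases under multiplication and under shifts, so a monomial of
   maximal weight may be added back. *)
Lemma stable_add U V (s : seq 'X_{1..n}) : stable U -> stable V -> s <> [::] ->
  [set` s] = V `\` U -> exists2 A, A \in s & stable (A |` U).
Proof.
move=> [upU shU] [upV shV] s0 sE.
have memE B : B \in s <-> V B /\ ~ U B.
  by have := congr1 (fun X => X B) sE; rewrite /setD /mkset /= => ->.
have [A As mA] := seq_max_weight s0; have [VA nUA] := (memE A).1 As.
have step B : V B -> weight A < weight B -> U B.
  move=> VB wB; apply: contrapT => nUB.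
  by have := mA B ((memE B).2 (conj VB nUB)); lia.
exists A => //; split.
  move=> B C [->|UB] BC; last by right; apply: upU BC.
  have [->|/eqP ne] := eqVneq A C; first by left.
  by right; apply: step; [apply: upV BC | apply: weight_lem].
move=> B i j [->|UB] Bj ij; last by right; apply: shU.
by right; apply: step; [apply: shV | apply: weight_shift].
Qed.

Lemma stable_setT : stable setT. Proof. by []. Qed.

End Monomials.

(** * Forgetting the last variable *)

Section Truncation.
Variable n : nat.
Local Notation widen := (widen_ord (leqnSn n)).
Implicit Types (A : 'X_{1..n.+1}) (B : 'X_{1..n}) (U V : set 'X_{1..n}).

Definition mnmtrunc A : 'X_{1..n} := [multinom A (widen i) | i < n].

(** Membership ignores the exponent of the last variable. Among stable sets, these are the monomial
    sets of saturated ideals, and passing from [U] to [cyl U] is extension of ideals to one more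
    variable. *)
Definition cyl U : set 'X_{1..n.+1} := [set A | U (mnmtrunc A)].

Lemma mnmtruncE A i : mnmtrunc A i = A (widen i).
Proof. exact: mnmE. Qed.

Lemma ord_maxP (i : 'I_n.+1) : i = ord_max \/ exists j, i = widen j.
Proof.
have [h|h] := ltnP i n; last by left; apply: val_inj => /=; have := ltn_ord i; lia.
by right; exists (Ordinal h); apply: val_inj.
Qed.

Lemma widen_neq_max (i : 'I_n) : (widen i == ord_max) = false.
Proof. by apply/negbTE/eqP => /(congr1 val) /=; have := ltn_ord i; lia. Qed.

Lemma mnm_truncP A A' :
  mnmtrunc A = mnmtrunc A' -> A ord_max = A' ord_max -> A = A'.
Proof.
move=> /mnmP t m; apply/mnmP => i; case: (ord_maxP i) => [->//|[j ->]].
by have := t j; rewrite !mnmtruncE.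
Qed.

Lemma mnmwidenK : cancel (@mnmwiden n) mnmtrunc.
Proof. by move=> B; apply/mnmP => i; rewrite mnmtruncE mnmwiden_widen. Qed.

Lemma mnmtruncD A A' : mnmtrunc (A + A')%MM = (mnmtrunc A + mnmtrunc A')%MM.
Proof. by apply/mnmP => i; rewrite !mnmE. Qed.

Lemma mnmtruncB A A' : mnmtrunc (A - A')%MM = (mnmtrunc A - mnmtrunc A')%MM.
Proof. by apply/mnmP => i; rewrite !mnmE. Qed.

Lemma mnmtrunc_max k : mnmtrunc (U_(ord_max) *+ k)%MM = 0%MM.
Proof.
by apply/mnmP => i; rewrite mnmtruncE mulmnE !mnmE eq_sym widen_neq_max.
Qed.

Lemma mnmtrunc1 i : mnmtrunc U_(widen i)%MM = U_(i)%MM.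
Proof. by rewrite -mnmwiden1 mnmwidenK. Qed.

Lemma mnmtrunc0 : mnmtrunc 0%MM = 0%MM.
Proof. by rewrite -mnmwiden0 mnmwidenK. Qed.

Lemma mnm_decomp A : A = (mnmwiden (mnmtrunc A) + U_(ord_max) *+ A ord_max)%MM.
Proof.
apply: mnm_truncP; first by rewrite mnmtruncD mnmwidenK mnmtrunc_max addm0.
by rewrite mnmDE mnmwiden_ordmax mulmnE mnm1E eqxx mul1n.
Qed.

Lemma mdeg_widen B : mdeg (mnmwiden B) = mdeg B.
Proof.
rewrite !mdegE big_ord_recr /= mnmwiden_ordmax addn0.
by apply: eq_bigr => i _; rewrite mnmwiden_widen.
Qed.

Lemma mdeg_trunc A : mdeg A = mdeg (mnmtrunc A) + A ord_max.
Proof.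
by rewrite {1}(mnm_decomp A) mdegD mdeg_widen mdegMn mdeg1 mul1n.
Qed.

Lemma lem_trunc A A' : (A <= A')%MM -> (mnmtrunc A <= mnmtrunc A')%MM.
Proof. by move/mnm_lepP => h; apply/mnm_lepP => i; rewrite !mnmtruncE. Qed.

Lemma lem_widen B A : (mnmwiden B <= A)%MM = (B <= mnmtrunc A)%MM.
Proof.
apply/idP/idP => [/lem_trunc|/mnm_lepP h]; first by rewrite mnmwidenK.
apply/mnm_lepP => i; case: (ord_maxP i) => [->|[j ->]].
  by rewrite mnmwiden_ordmax.
by have := h j; rewrite mnmtruncE mnmwiden_widen.
Qed.

Lemma cyl_widen U B : cyl U (mnmwiden B) = U B.
Proof. by rewrite /cyl /= mnmwidenK. Qed.

Lemma cyl_inj : injective cyl.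
Proof.
by move=> U V e; apply/seteqP; split=> B; rewrite -(cyl_widen U) e cyl_widen.
Qed.

Lemma cyl_setT : cyl setT = setT. Proof. by []. Qed.

Lemma cyl_upset U : upset U -> upset (cyl U).
Proof. by move=> up A A' UA /lem_trunc; apply: up. Qed.

Lemma cyl_stable U : stable U -> stable (cyl U).
Proof.
move=> [up sh]; split; first exact: cyl_upset.
move=> A i j; rewrite /cyl /= => UA Aj ij.
case: (ord_maxP i) => [e|[i' ei]].
  by move: ij; rewrite e /=; have := ltn_ord j; lia.
rewrite ei mnmtruncD mnmtruncB mnmtrunc1.
case: (ord_maxP j) => [->|[j' ej]].
  rewrite -(mulm1n U_(ord_max)) mnmtrunc_max subm0.
  by apply: up UA _; apply: lem_addr.
rewrite ej mnmtrunc1; apply: sh => //; first by rewrite mnmtruncE -ej.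
by move: ij; rewrite ei ej.
Qed.

Definition slice (W : set 'X_{1..n.+1}) : set 'X_{1..n} :=
  [set B | W (mnmwiden B)].

Lemma slice_stable W : stable W -> stable (slice W).
Proof.
move=> [up sh]; split=> [B C WB BC|B i j WB Bj ij].
  by apply: up WB _; rewrite lem_widen mnmwidenK.
rewrite /slice /=.
suff -> : mnmwiden (B - U_(j) + U_(i)) =
          (mnmwiden B - U_(widen j) + U_(widen i))%MM.
  by apply: sh => //; rewrite mnmwiden_widen.
rewrite mnmwidenD mnmwiden1; congr (_ + _)%MM.
apply: mnm_truncP; first by rewrite mnmwidenK mnmtruncB mnmwidenK mnmtrunc1.
by rewrite mnmwiden_ordmax mnmBE mnmwiden_ordmax.
Qed.

Lemma cyl_slice (W : set 'X_{1..n.+1}) : upset W ->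
  (forall A, W (A + U_(ord_max))%MM -> W A) -> W = cyl (slice W).
Proof.
move=> up cl; apply/seteqP; split=> A; rewrite /cyl /slice /=.
  rewrite {1}(mnm_decomp A); elim: (A ord_max) => [|k IH]; first by rewrite addm0.
  by rewrite mulmSr addmA => /cl.
by move=> h; apply: up h _; rewrite lem_widen lepm_refl.
Qed.

Lemma minimal_cyl U A :
  minimal (cyl U) A <-> exists2 B, A = mnmwiden B & minimal U B.
Proof.
split=> [[UA mA]|[B -> {A} [UB mB]]].
  have e : mnmwiden (mnmtrunc A) = A.
    by apply: mA; [rewrite cyl_widen | rewrite lem_widen lepm_refl].
  exists (mnmtrunc A) => //; split=> // B UB BA.
  have : mnmwiden B = A by apply: mA; [rewrite cyl_widen | rewrite lem_widen].
  by move=> <-; rewrite mnmwidenK.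
split=> [|A UA AB]; first by rewrite cyl_widen.
apply: mnm_truncP.
  by rewrite mnmwidenK; apply: mB => //; rewrite -(mnmwidenK B); apply: lem_trunc.
have /mnm_lepP/(_ ord_max) := AB; rewrite mnmwiden_ordmax; lia.
Qed.

End Truncation.

(** * Dickson's lemma and saturation with respect to the last variable *)

Section Finiteness.

(** Built from [basis] so that its length is the dimension of the space of homogeneous polynomials
    of degree [d]. *)
Definition monomials n d : seq 'X_{1..n} :=
  [seq s2m (val t) | t <- enum (basis n d)].

Lemma mem_monomials n d (A : 'X_{1..n}) : (A \in monomials n d) = (mdeg A == d).
Proof. by rewrite basis_cover. Qed.

Lemma uniq_monomials n d : uniq (monomials n d).
Proof. exact: uniq_basis. Qed.

Lemma finite_mdeg_le n d : finite_set [set A : 'X_{1..n} | mdeg A <= d].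
Proof.
apply/finite_seqP; exists (flatten [seq monomials n k | k <- iota 0 d.+1]).
apply/seteqP; split=> A.
  rewrite /mkset => h; apply/flatten_mapP.
  by exists (mdeg A); rewrite ?mem_iota ?mem_monomials.
rewrite /mkset => /flatten_mapP[k].
by rewrite mem_iota mem_monomials => h /eqP ->; move: h; lia.
Qed.

Lemma finite_bound (T : choiceType) (D : set T) (P : T -> nat -> Prop) :
  finite_set D -> (forall x k l, P x k -> k <= l -> P x l) ->
  (forall x, D x -> exists k, P x k) -> exists k, forall x, D x -> P x k.
Proof.
move=> /finite_seqP[s ->] mono; elim: s => [|x s IH] h; first by exists 0.
have [k hk] : exists k, forall y, [set` s] y -> P y k.
  by apply: IH => y /= ys; apply: h; rewrite /= inE ys orbT.
have [|l hl] := h x; first by rewrite /= mem_head.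
exists (maxn k l) => y /=; rewrite inE => /orP[/eqP ->|ys].
  by apply: mono hl _; rewrite leq_maxr.
by apply: mono (hk y ys) _; rewrite leq_maxl.
Qed.

(* Dickson's lemma, as a bound on the degrees of the generators. *)
Lemma dickson n (U : set 'X_{1..n}) : upset U -> exists N, forall A, U A ->
  exists B, [/\ U B, (B <= A)%MM & mdeg B <= N].
Proof.
elim: n U => [|n IH] U up.
  exists 0 => A UA; exists A; split=> //; first exact: lepm_refl.
  by rewrite mdegE big_ord0.
(* The layers, indexed by the exponent of the last variable, increase with [k]. Generators of their
   union have bounded degree by induction, hence are finite in number and all occur in some layer
   [J], after which the layers are constant. Only the layers up to [J] need generators of their
   own. *)
pose layer k : set 'X_{1..n} := [set B | U (mnmwiden B + U_(ord_max) *+ k)%MM].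
have layer_le B k l : layer k B -> k <= l -> layer l B.
  rewrite /layer /= => h /subnKC <-; apply: up h _; apply/mnm_lepP => i.
  by rewrite !(mnmE, mulmnE) mulnDr addnA leq_addr.
have layer_up k : upset (layer k).
  move=> B C h /mnm_lepP BC; apply: up h _; apply/mnm_lepP => i.
  rewrite 2!mnmDE leq_add2r; case: (ord_maxP i) => [->|[j ->]].
    by rewrite !mnmwiden_ordmax.
  by rewrite !mnmwiden_widen.
have [N0 hN0] : exists N, forall B, (exists k, layer k B) ->
    exists C, [/\ exists k, layer k C, (C <= B)%MM & mdeg C <= N].
  by apply: (IH [set B | exists k, layer k B]) => B C [k hB] BC; exists k;
     apply: layer_up BC.
have [J hJ] : exists J, forall B, (mdeg B <= N0 /\ exists k, layer k B) ->
    layer J B.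
  apply: (finite_bound (P := fun B k => layer k B)) => //; last by move=> B [].
  by apply: sub_finite_set (finite_mdeg_le n N0) => B [].
have [N hN] : exists N, forall j, j <= J -> forall B, layer j B ->
    exists C, [/\ layer j C, (C <= B)%MM & mdeg C <= N].
  apply: (finite_bound (D := [set j | j <= J]) (P := fun j N => forall B,
    layer j B -> exists C, [/\ layer j C, (C <= B)%MM & mdeg C <= N])).
  - apply/finite_seqP; exists (iota 0 J.+1); apply/seteqP.
    by split=> j; rewrite /mkset mem_iota.
  - move=> j k l h kl B /h[C [? ? ?]]; exists C; split=> //; lia.
  - by move=> j _; apply: IH.
exists (N + J) => A UA.
have lA : layer (A ord_max) (mnmtrunc A) by rewrite /layer /= -mnm_decomp.
suff [j [C [jJ jA lC CA CN]]] : exists j C, [/\ j <= J, j <= A ord_max,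
    layer j C, (C <= mnmtrunc A)%MM & mdeg C <= N].
  exists (mnmwiden C + U_(ord_max) *+ j)%MM; split=> //; last first.
    by rewrite mdegD mdeg_widen mdegMn mdeg1 mul1n leq_add.
  apply/mnm_lepP => i.
  rewrite [X in (_ <= fun_of_multinom X i)%N](mnm_decomp A) !(mnmDE, mulmnE).
  apply: leq_add; last by rewrite leq_mul2l jA orbT.
  by move: i; apply/mnm_lepP; rewrite lem_widen mnmwidenK.
have [h|h] := leqP (A ord_max) J.
  by have [C [? ? ?]] := hN _ h _ lA; exists (A ord_max), C; split.
have [|C [kC CA CN0]] := hN0 (mnmtrunc A); first by exists (A ord_max).
have lJA : layer J (mnmtrunc A) by apply: layer_up CA; apply: hJ.
by have [D [? ? ?]] := hN _ (leqnn J) _ lJA; exists J, D; split=> //; lia.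
Qed.

Lemma finite_minimal n (U : set 'X_{1..n}) : upset U -> finite_set (minimal U).
Proof.
move=> /dickson[N hN]; apply: sub_finite_set (finite_mdeg_le n N) => A [UA mA] /=.
by have [B [UB BA BN]] := hN _ UA; rewrite -(mA _ UB BA).
Qed.

(** The result of setting the last variable equal to 1 in the monomials of [W]. *)
Definition last_sat n (W : set 'X_{1..n.+1}) : set 'X_{1..n} :=
  [set B | exists k, W (mnmwiden B + U_(ord_max) *+ k)%MM].

Variable n : nat.
Local Notation widen := (widen_ord (leqnSn n)).
Implicit Type W : set 'X_{1..n.+1}.

(* x_m^k can be replaced, one variable at a time, by any monomial of degree k. *)
Lemma stable_last W A C k : stable W -> W (A + U_(ord_max) *+ k)%MM ->
  k <= mdeg C -> W (A + C)%MM.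
Proof.
move=> [up sh]; elim: k A C => [|k IH] A C WA kC.
  by apply: up WA _; rewrite addm0 lem_addr.
have [i Ci] : exists i, 0 < C i.
  by apply: mnm_neq0P => C0; move: kC; rewrite C0 mdeg0.
rewrite -(mnmB_add Ci) (addmC _ U_(i)%MM) addmA; apply: IH; last first.
  by move: kC; rewrite -{1}(mnmB_add Ci) mdegD mdeg1; lia.
have -> : (A + U_(i) + U_(ord_max) *+ k =
    A + U_(ord_max) *+ k.+1 - U_(ord_max) + U_(i))%MM.
  by rewrite mulmSr addmA addmK -!addmA (addmC U_(i)%MM).
case: (ord_maxP i) => [->|[j e]].
  by rewrite mnmB_add // !mnmE mulmnE mnm1E eqxx addn_gt0 mul1n orbT.
apply: sh => //; last by rewrite e /=.
by rewrite mnmDE mulmnE mnm1E eqxx mul1n addn_gt0 orbT.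
Qed.

Lemma last_sat_stable W : stable W -> stable (last_sat W).
Proof.
move=> [up sh]; split=> [B C [k h] BC|B i j [k h] Bj ij]; exists k.
  apply: up h _; apply/mnm_lepP => i; rewrite 2!mnmDE leq_add2r.
  by apply/mnm_lepP: i; rewrite lem_widen mnmwidenK.
suff -> : (mnmwiden (B - U_(j) + U_(i)) + U_(ord_max) *+ k =
   (mnmwiden B + U_(ord_max) *+ k) - U_(widen j) + U_(widen i))%MM.
  by apply: sh => //; rewrite mnmDE mnmwiden_widen; lia.
apply: mnm_truncP.
  by rewrite !(mnmtruncD, mnmtruncB) !mnmwidenK !mnmtrunc_max !mnmtrunc1 !addm0.
rewrite !(mnmDE, mnmBE) !mnmwiden_ordmax !mnm1E !widen_neq_max; lia.
Qed.

Lemma sub_last_sat W : upset W -> W `<=` cyl (last_sat W).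
Proof. by move=> up A WA; exists (A ord_max); rewrite -mnm_decomp. Qed.

(** Dickson's lemma bounds the degrees of generators of [last_sat W] by some [N], and one power [k]
    of the last variable brings all of them into [W]. A monomial of degree above [N + k] in the
    cylinder is such a generator times a cofactor of degree at least [k], and by [stable_last] that
    cofactor does as well as the power. *)
Lemma finite_last_sat W : stable W -> finite_set (cyl (last_sat W) `\` W).
Proof.
move=> sW; have [up _] := sW.
have [N hN] := dickson (last_sat_stable sW).1.
have [k hk] : exists k, forall B, mdeg B <= N /\ last_sat W B ->
    W (mnmwiden B + U_(ord_max) *+ k)%MM.
  apply: (finite_bound (P := fun B k => W (mnmwiden B + U_(ord_max) *+ k)%MM)).
  - by apply: sub_finite_set (finite_mdeg_le n N) => B [].
  - move=> B k l h /subnKC <-; apply: up h _; apply/mnm_lepP => i.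
    by rewrite !(mnmE, mulmnE) mulnDr addnA leq_addr.
  - by move=> B [].
apply: sub_finite_set (finite_mdeg_le _ (N + k)) => A [WA nA] /=.
rewrite leqNgt; apply/negP => hA; apply: nA.
have [B [WB BA BN]] := hN _ WA.
rewrite -lem_widen in BA; rewrite -(submK BA) addmC.
apply: stable_last sW (hk _ (conj BN WB)) _.
move: hA; rewrite -{1}(submK BA) mdegD mdeg_widen; lia.
Qed.

End Finiteness.

(** * Counting monomials and differences of polynomials *)

Section Counting.

(** The Hilbert function of the quotient by the monomial ideal of [U], as shown in
    [hilbert_functionP]. *)
Definition cocount n (U : set 'X_{1..n}) k :=
  count (fun A => `[< ~ U A >]) (monomials n k).

(** Monomials of degree [k + 1] either are divisible by the last variable, and dividing by it does
    not affect membership in the cylinder, or do not involve it. This is the count behind the exact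
    sequence for multiplication by the last variable. *)
Lemma cocount_cyl n (U : set 'X_{1..n}) k :
  cocount (cyl U) k.+1 = cocount (cyl U) k + cocount U k.+1.
Proof.
pose s1 := [seq (A + U_(ord_max))%MM | A <- monomials n.+1 k].
pose s2 := [seq mnmwiden B | B <- monomials n k.+1].
have perm : perm_eq (monomials n.+1 k.+1) (s1 ++ s2).
  apply: uniq_perm; first exact: uniq_monomials.
    rewrite cat_uniq (map_inj_uniq (@addIm _ _)) (map_inj_uniq (@inj_mnmwiden _)).
    rewrite !uniq_monomials andbT /=.
    apply/hasPn => A /mapP[B _ ->]; apply/mapP => -[C _].
    by move=> /mnmP/(_ ord_max); rewrite mnmwiden_ordmax mnmDE mnm1E eqxx addn1.
  move=> A; rewrite mem_cat mem_monomials; apply/idP/orP.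
    move=> /eqP hA; have [A0|Am] := posnP (A ord_max).
      right; apply/mapP; exists (mnmtrunc A).
        by rewrite mem_monomials -hA mdeg_trunc A0 addn0.
      by rewrite {1}(mnm_decomp A) A0 mulm0n addm0.
    left; apply/mapP; exists (A - U_(ord_max))%MM; last by rewrite mnmB_add.
    by rewrite mem_monomials; move: hA; rewrite -{1}(mnmB_add Am) mdegD mdeg1; lia.
  case=> /mapP[B]; rewrite mem_monomials => /eqP hB ->.
    by rewrite mdegD mdeg1 hB addn1.
  by rewrite mdeg_widen hB.
rewrite /cocount (permP perm) count_cat !count_map; congr (_ + _).
  apply: eq_count => A /=; apply: asbool_equiv_eq.
  by rewrite /cyl /= mnmtruncD -(mulm1n U_(ord_max)) mnmtrunc_max addm0.
by apply: eq_count => A /=; rewrite cyl_widen.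
Qed.

Lemma cocount_cyl0 n (U : set 'X_{1..n}) : cocount (cyl U) 0 = cocount U 0.
Proof.
have perm m : perm_eq (monomials m 0) [:: 0%MM].
  apply: uniq_perm; rewrite ?uniq_monomials // => A.
  by rewrite mem_monomials inE mdeg_eq0.
by rewrite /cocount !(permP (perm _)) /= /cyl /= mnmtrunc0.
Qed.

Lemma cocount_setT n k : cocount (@setT 'X_{1..n}) k = 0.
Proof.
rewrite /cocount -(@count_pred0 _ (monomials n k)); apply: eq_count => A /=.
by apply: asboolF; apply.
Qed.

Variables (n : nat) (U V : set 'X_{1..n}) (s : seq 'X_{1..n}).
Hypotheses (UV : U `<=` V) (us : uniq s) (sE : [set` s] = V `\` U).

Lemma cocount_sub k :
  cocount U k = cocount V k + count (fun A => mdeg A == k) s.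
Proof.
have memE B : reflect (V B /\ ~ U B) (B \in s).
  have := congr1 (fun X => X B) sE; rewrite /setD /mkset /= => <-; exact: idP.
have -> : count (fun A => mdeg A == k) s = count (mem s) (monomials n k).
  rewrite -!size_filter; apply/perm_size/uniq_perm.
  - exact: filter_uniq.
  - by apply: filter_uniq; apply: uniq_monomials.
  - by move=> A; rewrite !mem_filter mem_monomials andbC.
rewrite /cocount -count_predUI.
rewrite [X in _ = _ + X](eq_count (a2 := pred0)); last first.
  move=> A /=; apply/negbTE/andP => -[/asboolP h /memE[/h []]].
rewrite count_pred0 addn0; apply: eq_count => A /=.
apply/asboolP/orP => [nUA|[/asboolP nV /UV//|/memE[]//]].
have [VA|nVA] := pselect (V A); last by left; apply/asboolP.
by right; apply/memE.
Qed.

(** Each monomial of [s] contributes, in every degree from its own on, exactly one multiple by a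
    power of the last variable. *)
Lemma cocount_cyl_sub k :
  cocount (cyl U) k = cocount (cyl V) k + count (fun A => mdeg A <= k) s.
Proof.
elim: k => [|k IH].
  rewrite !cocount_cyl0 cocount_sub; congr (_ + _).
  by apply: eq_count => A /=; lia.
rewrite !cocount_cyl IH cocount_sub.
suff -> : count (fun A => mdeg A <= k.+1) s =
  count (fun A => mdeg A <= k) s + count (fun A => mdeg A == k.+1) s by lia.
rewrite -count_predUI [X in _ = _ + X](eq_count (a2 := pred0)) ?count_pred0.
  by rewrite addn0; apply: eq_count => A /=; lia.
by move=> A /=; lia.
Qed.

Lemma cocount_cyl_sub_large : exists N, forall k, N <= k ->
  cocount (cyl U) k = cocount (cyl V) k + size s.
Proof.
(* The sum of the degrees serves as a common bound for the degrees in [s]. *)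
exists (\sum_(A <- s) mdeg A) => k hk; rewrite cocount_cyl_sub; congr (_ + _).
apply/eqP; rewrite -all_count; apply/allP => A As.
by apply: leq_trans hk; rewrite (big_rem A) //= leq_addr.
Qed.

Lemma cocount_sub_large : exists N, forall k, N <= k ->
  cocount U k = cocount V k.
Proof.
exists (\sum_(A <- s) mdeg A).+1 => k hk; rewrite cocount_sub.
rewrite (eq_in_count (a2 := pred0)) ?count_pred0 ?addn0 // => A As.
apply/negbTE; rewrite neq_ltn; apply/orP; left; apply: leq_trans hk.
by rewrite ltnS (big_rem A) //= leq_addr.
Qed.

End Counting.

Lemma finite_uniq_enum (T : choiceType) (D : set T) :
  finite_set D -> exists2 s : seq T, uniq s & [set` s] = D.
Proof.
move=> /finite_seqP[s ->]; exists (undup s); first exact: undup_uniq.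
by apply/seteqP; split=> x; rewrite /mkset mem_undup.
Qed.

(** * Backward differences of rational polynomials *)

Section Polynomials.
Local Open Scope ring_scope.
Implicit Types p q : {poly rat}.

Lemma poly_large_eq p q :
  (exists N, forall k : nat, (N <= k)%N -> p.[k%:R] = q.[k%:R]) -> p = q.
Proof.
move=> [N h]; apply/eqP; rewrite -subr_eq0; apply/eqP.
pose s : seq rat := [seq k%:R | k <- iota N (size (p - q))].
apply: (roots_geq_poly_eq0 (rs := s)).
- apply/allP => x /mapP[k]; rewrite mem_iota => /andP[Nk _] ->.
  by rewrite rootE hornerD hornerN h ?subrr.
- rewrite map_inj_uniq ?iota_uniq // => i j /eqP; rewrite eqr_nat => /eqP //.
- by rewrite size_map size_iota.
Qed.

Lemma horner_backward_diff p x : (backward_diff p).[x] = p.[x] - p.[x - 1].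
Proof. by rewrite /backward_diff hornerD hornerN horner_comp !hornerE. Qed.

Lemma backward_diffB p q :
  backward_diff (p - q) = backward_diff p - backward_diff q.
Proof. by rewrite /backward_diff comp_polyB; ring. Qed.

Lemma DeltaS j p : Delta j.+1 p = backward_diff (Delta j p). Proof. by []. Qed.

Lemma DeltaB j p q : Delta j (p - q) = Delta j p - Delta j q.
Proof. by elim: j => // j IH; rewrite !DeltaS IH backward_diffB. Qed.

(** In the factorisation of [X^(n+1) - (X-1)^(n+1)] the linear factor is 1, which leaves a sum of
    [n + 1] monic polynomials of degree [n]. *)
Lemma backward_diff_Xn n :
  (size (backward_diff ('X^(n.+1))) <= n.+1)%N /\
  (backward_diff ('X^(n.+1)))`_n = n.+1%:R.
Proof.
have -> : backward_diff 'X^(n.+1) =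
    \sum_(i < n.+1) 'X^(n - i) * ('X - 1%:P) ^+ i.
  by rewrite /backward_diff comp_Xn_poly subrXX opprB addrC subrK mul1r.
have hs (i : 'I_n.+1) :
    size ('X^(n - i) * ('X - 1%:P) ^+ i : {poly rat}) = n.+1.
  rewrite size_Mmonic ?monic_neq0 ?monicXn ?monic_exp ?monicXsubC //.
  by rewrite size_polyXn size_exp_XsubC; have := ltn_ord i; lia.
have hm (i : 'I_n.+1) : 'X^(n - i) * ('X - 1%:P) ^+ i \is @monic rat.
  by rewrite monicMl ?monicXn ?monic_exp ?monicXsubC.
split.
  apply: leq_trans (size_sum _ _ _) _; apply/bigmax_leqP => i _.
  by rewrite hs.
rewrite coef_sum (eq_bigr (fun=> 1)) => [|i _].
  by rewrite sumr_const card_ord.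
by have /monicP := hm i; rewrite /lead_coef hs.
Qed.

Lemma backward_diffC c : backward_diff c%:P = 0.
Proof. by rewrite /backward_diff comp_polyC subrr. Qed.

Lemma backward_diff_lead n p : (size p <= n.+2)%N ->
  (size (backward_diff p) <= n.+1)%N /\
  (backward_diff p)`_n = p`_n.+1 * n.+1%:R.
Proof.
move=> hp.
have -> : backward_diff p = \sum_(i < n.+1) p`_i.+1 *: backward_diff 'X^(i.+1).
  rewrite -[LHS](_ : \sum_(i < n.+2) p`_i *: backward_diff 'X^i = _).
    by rewrite big_ord_recl expr0 -polyC1 backward_diffC scaler0 add0r.
  have e : p = \sum_(i < n.+2) p`_i *: 'X^i.
    rewrite -poly_def; apply/polyP => i; rewrite coef_poly.
    by case: ltnP => // h; rewrite nth_default //; apply: leq_trans hp h.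
  rewrite /backward_diff [in RHS]e linear_sum -sumrB; apply: eq_bigr => i _.
  by rewrite scalerBr -comp_polyZ.
split.
  apply: leq_trans (size_sum _ _ _) _; apply/bigmax_leqP => i _.
  apply: leq_trans (size_scale_leq _ _) _.
  by have [h _] := backward_diff_Xn i; apply: leq_trans h (ltn_ord i).
rewrite coef_sum big_ord_recr /= coefZ (backward_diff_Xn n).2 big1 ?add0r // => i _.
rewrite coefZ [(backward_diff _)`_n]nth_default ?mulr0 //.
by have [h _] := backward_diff_Xn i; apply: leq_trans h (ltn_ord i).
Qed.

(** In characteristic 0 the new leading coefficient, a positive integer multiple of the old one,
    does not vanish. Truncated subtraction accounts for the differences that are already zero. *)
Lemma size_Delta j p : size (Delta j p) = (size p - j)%N.
Proof.
elim: j => [|j IH]; first by rewrite subn0.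
rewrite DeltaS subnS -IH; case E: (size (Delta j p)) => [|[|k]] /=.
- by move/eqP: E; rewrite size_poly_eq0 => /eqP ->; rewrite backward_diffC size_poly0.
- by rewrite (size1_polyC (eq_leq E)) backward_diffC size_poly0.
have [h1 h2] := backward_diff_lead (eq_leq E).
apply/eqP; rewrite eqn_leq h1 /= ltnNge; apply/negP => /(nth_default 0).
move=> h; move: h2; rewrite h => /esym/eqP; rewrite mulf_eq0 pnatr_eq0 orbF.
by apply/negP; rewrite -[k.+1]/(k.+2.-1) -E -/(lead_coef _) lead_coef_eq0
  -size_poly_eq0 E.
Qed.

Lemma Delta_int j p :
  (exists N, forall k : nat, (N <= k)%N -> p.[k%:R] \is a Num.int) ->
  exists N, forall k : nat, (N <= k)%N -> (Delta j p).[k%:R] \is a Num.int.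
Proof.
move=> h; elim: j => // j [N hN]; exists N.+1 => -[//|k] hk.
rewrite DeltaS horner_backward_diff -natr1 addrK rpredB ?hN //.
by rewrite natr1 hN //; lia.
Qed.

(** A polynomial whose difference is eventually at most -1 falls by at least 1 at each step, so it
    is eventually at most -1 itself. This serves to contradict lower bounds on values of Hilbert
    polynomials. *)
Lemma Delta_neg j p :
  (exists N, forall k : nat, (N <= k)%N -> (Delta j p).[k%:R] <= -1) ->
  exists N, forall k : nat, (N <= k)%N -> p.[k%:R] <= -1.
Proof.
elim: j => // j IH [N hN]; apply: IH.
pose c := (Delta j p).[N%:R].
have bnd k : (Delta j p).[(N + k)%:R] <= c - k%:R.
  elim: k => [|k IH]; first by rewrite addn0 subr0.
  have := hN (N + k.+1)%N (leq_addr _ _).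
  rewrite DeltaS horner_backward_diff addnS -natr1 addrK -[k.+1%:R]natr1.
  lra.
(* More than [c + 1] steps of decrease bring the value [c] at [N] below -1. *)
exists (N + Num.bound (`|c + 1|%R))%N => k hk.
have hk' : k = (N + (k - N))%N by lia.
rewrite hk'; apply: le_trans (bnd _) _.
have h1 : c + 1 < (k - N)%:R.
  apply: le_lt_trans (ler_norm _) _.
  apply: lt_le_trans (archi_boundP (normr_ge0 _)) _.
  by rewrite ler_nat leq_subRL //; apply: leq_trans hk; apply: leq_addr.
lra.
Qed.
End Polynomials.

Local Open Scope ring_scope.

(** * Monomial ideals *)

Section MonomialIdeals.
Variables (K : fieldType) (m : nat).
Local Notation S := {mpoly K[m.+1]}.
Implicit Types (A B C : 'X_{1..m.+1}) (U V W : set 'X_{1..m.+1}) (I J : set S).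

(** Described by supports rather than by generators, so that membership is decided monomial by
    monomial. It is an ideal when [U] is an up-set. *)
Definition mon_ideal U : set S := [set f | forall A, A \in msupp f -> U A].

Lemma mon_idealX U A : mon_ideal U 'X_[A] <-> U A.
Proof.
split=> [h|UA B]; first by apply: h; rewrite msuppX mem_head.
by rewrite msuppX inE => /eqP ->.
Qed.

Lemma mon_ideal_inj : injective mon_ideal.
Proof. by move=> U V e; apply/seteqP; split=> A; rewrite -!mon_idealX e. Qed.

Lemma mon_idealT : mon_ideal setT = setT.
Proof. by apply/seteqP. Qed.

Lemma mon_ideal_ideal U : upset U -> is_ideal (mon_ideal U).
Proof.
move=> up; split.
- by move=> A; rewrite msupp0.
- by move=> f g hf hg A /msuppD_le; rewrite mem_cat => /orP[/hf|/hg].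
- move=> f g hg A /msuppM_le /allpairsP[[B C] /= [_ /hg UC ->]].
  by apply: up UC _; apply: lem_addl.
Qed.

Lemma ideal_gen_ideal (X : set S) : is_ideal (ideal_gen X).
Proof.
split.
- by move=> I [[]].
- by move=> f g hf hg I [iI XI]; have [_ D _] := iI; apply: D; [apply: hf|apply: hg].
- by move=> f g hg I [iI XI]; have [_ _ M] := iI; apply: M; apply: hg.
Qed.

Lemma sub_ideal_gen (X : set S) : X `<=` ideal_gen X.
Proof. by move=> f Xf I [_]; apply. Qed.

Lemma ideal_gen_sub (X I : set S) : is_ideal I -> X `<=` I -> ideal_gen X `<=` I.
Proof. by move=> iI XI f; apply. Qed.

Lemma ideal_mpoly I f :
  is_ideal I -> (forall A, A \in msupp f -> I 'X_[A]) -> I f.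
Proof.
move=> [I0 ID IM] h; rewrite (mpolyE f) big_seq.
apply: (big_ind (fun g => I g)) => // A Af.
by rewrite -mul_mpolyC; apply: IM; apply: h.
Qed.

Definition upclosure (M : set 'X_{1..m.+1}) : set 'X_{1..m.+1} :=
  [set B | exists2 A, M A & (A <= B)%MM].

Lemma upclosure_upset M : upset (upclosure M).
Proof. by move=> B C [A MA AB] BC; exists A => //; apply: lepm_trans AB BC. Qed.

Lemma upclosure_id U : upset U -> upclosure U = U.
Proof.
move=> up; apply/seteqP; split=> [A [B UB]|A UA]; first exact: up.
by exists A => //; apply: lepm_refl.
Qed.

Lemma ideal_gen_mon (M : set 'X_{1..m.+1}) :
  ideal_gen [set 'X_[A] | A in M] = mon_ideal (upclosure M).
Proof.
apply/seteqP; split.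
  apply: ideal_gen_sub; first exact/mon_ideal_ideal/upclosure_upset.
  move=> _ [A MA <-]; apply/mon_idealX; exists A => //; exact: lepm_refl.
move=> f hf; apply: ideal_mpoly; first exact: ideal_gen_ideal.
move=> A /hf[B MB /submK <-]; rewrite mpolyXD.
have [_ _ IM] := ideal_gen_ideal [set ('X_[A] : S) | A in M].
by apply: IM; apply: sub_ideal_gen; exists B.
Qed.

Lemma strongly_stableP I :
  strongly_stable I <-> exists2 U, stable U & I = mon_ideal U.
Proof.
split=> [[[M ->] sh]|[U [up sh] ->]].
  rewrite ideal_gen_mon in sh *; exists (upclosure M) => //.
  split; first exact: upclosure_upset.
  by move=> A i j UA Aj ij; apply/mon_idealX; apply: sh => //; apply/mon_idealX.
split; first by exists U; rewrite ideal_gen_mon upclosure_id.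
by move=> A i j /mon_idealX UA Aj ij; apply/mon_idealX; apply: sh.
Qed.

Lemma irrelevant_powX k : ideal_pow (@irrelevant_ideal K m) k 'X_[U_(ord_max) *+ k].
Proof.
elim: k => [//|k IH]; apply: sub_ideal_gen.
exists 'X_[U_(ord_max)], 'X_[U_(ord_max) *+ k]; split=> //.
  by apply: sub_ideal_gen; exists ord_max.
by rewrite -mpolyXD mulmS.
Qed.

(** If [A] times the last variable lies in [U], then by left shifts so does [A] times any variable,
    which puts [x^A] in the saturation with exponent 1. In the other direction it suffices to test
    with powers of the last variable. *)
Lemma saturated_monP U : stable U ->
  (saturated (mon_ideal U) <-> forall A, U (A + U_(ord_max))%MM -> U A).
Proof.
move=> [up sh]; have [_ _ IM] := mon_ideal_ideal up; split.
  move=> sat A UA; apply/mon_idealX; rewrite -sat; exists 1%N => g.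
  rewrite /ideal_pow /= => hg.
  (* This is the colon ideal by [x^A]; to contain the irrelevant ideal it need only contain the
     variables. *)
  have iQ : is_ideal [set g : S | mon_ideal U (g * 'X_[A])].
    have [I0 ID _] := mon_ideal_ideal up.
    split; rewrite /mkset; first by rewrite mul0r.
      by move=> f h hf hh; rewrite mulrDl; apply: ID.
    by move=> f h hh; rewrite -mulrA; apply: IM.
  apply: (hg [set g : S | mon_ideal U (g * 'X_[A])]); split=> //.
  move=> _ [f [h [hf _ ->]]]; rewrite /mkset (mulrC f) -mulrA; apply: IM.
  apply: (hf [set g : S | mon_ideal U (g * 'X_[A])]); split=> // _ [i _ <-].
  rewrite /mkset -mpolyXD; apply/mon_idealX.
  case: (ord_maxP i) => [->|[j e]]; first by rewrite addmC.
  have -> : (U_(i) + A = A + U_(ord_max) - U_(ord_max) + U_(i))%MM.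
    by rewrite addmK addmC.
  apply: sh => //; first by rewrite mnmDE mnm1E eqxx addn1.
  by rewrite e /=.
move=> cl; apply/seteqP; split=> [f [k h] A Af|f hf]; last first.
  by exists 0%N => g _; apply: IM.
have clk l B : U (B + U_(ord_max) *+ l)%MM -> U B.
  elim: l => [|l IH]; first by rewrite addm0.
  by rewrite mulmSr addmA => /cl.
(* Multiplying [f] by the [k]-th power of the last variable merely translates its support. *)
apply: (clk k); apply: (h _ (irrelevant_powX k)).
rewrite mulrC mcoeff_msupp addmC mcoeffMX.
by rewrite -mcoeff_msupp.
Qed.
End MonomialIdeals.

Lemma extend_mon (K : fieldType) (m : nat) (U : set 'X_{1..m.+1}) : upset U ->
  extend (mon_ideal U) = mon_ideal (cyl U) :> set {mpoly K[m.+2]}.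
Proof.
move=> up; have icyl := mon_ideal_ideal K (cyl_upset up).
apply/seteqP; split.
  apply: ideal_gen_sub => // _ [f Uf <-].
  rewrite (mpolyE f) raddf_sum /= big_seq; have [I0 ID IM] := icyl.
  apply: (big_ind (fun g => mon_ideal (cyl U) g)) => // A /Uf UA.
  rewrite mwidenZ mwidenX -mul_mpolyC; apply: IM.
  by apply/mon_idealX; rewrite cyl_widen.
move=> f Uf; apply: ideal_mpoly => [|A /Uf UA]; first exact: ideal_gen_ideal.
rewrite (mnm_decomp A) addmC mpolyXD.
have [_ _ IM] := ideal_gen_ideal [set mwiden g | g in mon_ideal (K := K) U].
apply: IM; apply: sub_ideal_gen; exists 'X_[mnmtrunc A]; last exact: mwidenX.
exact/mon_idealX.
Qed.

(** * Hilbert functions of monomial ideals *)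

Section HilbertFunction.
Variables (K : fieldType) (m k : nat).
Implicit Types (A B : 'X_{1..m.+1}) (U : set 'X_{1..m.+1}).
Local Notation H := (dhomog m.+1 K k).

(** The value is the default 0 unless [A] has degree [k]. *)
Let mon A : H := indhomog k 'X_[A].

Let val_mon A : mdeg A = k -> val (mon A) = 'X_[A].
Proof. move=> h; apply: (insubdK (0 : H)).
by rewrite -topredE /= dhomogX -h eqxx. Qed.

Let mons (P : pred 'X_{1..m.+1}) : seq H :=
  [seq mon A | A <- monomials m.+1 k & P A].

Let span_mons (P : pred 'X_{1..m.+1}) (f : H) :
  reflect (forall A, A \in msupp (val f) -> P A) (f \in <<mons P>>%VS).
Proof.
apply: (iffP idP) => [/(coord_span (X := in_tuple (mons P))) fE A|h].
  apply: contraTT => nPA; rewrite mcoeff_msupp negbK fE raddf_sum raddf_sum /=.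
  apply/eqP; rewrite big1 // => i _.
  rewrite linearZ /=.
  have /mapP[B] := mem_nth 0 (ltn_ord i : (i < size (mons P))%N).
  rewrite mem_filter mem_monomials => /andP[PB /eqP hB] ->.
  rewrite -[mpoly_of_dhomog _]/(val _) val_mon // mcoeffX.
  by case: eqP PB nPA => [->|_ _ _]; [move=> -> | rewrite mulr0].
have fE : f = \sum_(A <- msupp (val f)) (val f)@_A *: mon A.
  apply: val_inj; rewrite raddf_sum /= {1}(mpolyE (val f)) big_seq [in RHS]big_seq.
  apply: eq_bigr => A Af; congr (_ *: _).
  rewrite -[RHS]/(val _) val_mon //.
  by have /dhomogP := dhomog_is_dhomog f; apply.
rewrite fE big_seq; apply: memv_suml => A Af; apply: memvZ; apply: memv_span.
apply: map_f; rewrite mem_filter h //= mem_monomials.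
by have /dhomogP/(_ _ Af)-> := dhomog_is_dhomog f.
Qed.

Let dim_full : \dim {: H} = size (monomials m.+1 k).
Proof. by rewrite /monomials size_basis dimvf. Qed.

(** Linear independence is replaced by a count: the spans for [P] and for its complement have at
    most the expected dimensions and together fill the whole space, so both bounds are attained. *)
Let dim_mons (P : pred 'X_{1..m.+1}) : \dim <<mons P>> = count P (monomials m.+1 k).
Proof.
have le Q : (\dim <<mons Q>> <= count Q (monomials m.+1 k))%N.
  by apply: leq_trans (dim_span _) _; rewrite size_map size_filter.
have full : (<<mons P>> + <<mons (predC P)>>)%VS = {: H}%VS.
  apply/eqP; rewrite eqEsubv subvf -span_cat /=; apply/subvP => f _.
  have : f \in <<mons predT>>%VS by apply/span_mons.
  apply/subvP/span_subvP => g /mapP[A]; rewrite mem_filter /= => hA ->.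
  apply: memv_span; rewrite mem_cat; case PA : (P A).
    by apply/orP; left; apply: map_f; rewrite mem_filter PA.
  by apply/orP; right; apply: map_f; rewrite mem_filter /= PA.
have := count_predC P (monomials m.+1 k); have := le P; have := le (predC P).
rewrite -dim_full -full; have := dimv_add_leqif <<mons P>> <<mons (predC P)>>.
move=> [h1 _] h2 h3 h4.
apply/eqP; rewrite eqn_leq h3 /= -(leq_add2r (count (predC P) (monomials m.+1 k))).
by rewrite h4; apply: leq_trans h1 _; rewrite leq_add2l.
Qed.

Lemma hilbert_functionP U h :
  hilbert_function (mon_ideal (K := K) U) k h <-> h = cocount U k.
Proof.
pose P A := `[< U A >].
have VP (V : {vspace H}) :
    (forall f : H, f \in V <-> mon_ideal U (f : {mpoly K[m.+1]})) -> V = <<mons P>>%VS.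
  move=> hV; apply/vspaceP => f; apply/idP/span_mons => [/hV h' A /h'/asboolP //|h'].
  by apply/hV => A /h'/asboolP.
have cE : (cocount U k + \dim <<mons P>> = \dim {: H})%N.
  rewrite dim_mons dim_full -(count_predC P) addnC; congr (_ + _)%N.
  by apply: eq_count => A /=; rewrite asbool_neg.
split=> [[V [/VP -> e]]|->]; first by move: cE; rewrite -e => /addIn.
exists <<mons P>>%VS; split=> // f; split=> [/span_mons h' A /h'/asboolP //|h'].
by apply/span_mons => A /h'/asboolP.
Qed.

End HilbertFunction.

(** * Saturated strongly stable ideals and their generators *)

Section SaturatedStable.
Variables (K : fieldType) (m : nat).
Local Notation S := {mpoly K[m.+1]}.
Local Notation widen := (widen_ord (leqnSn m)).
Implicit Types (A : 'X_{1..m.+1}) (B : 'X_{1..m}) (U V W : set 'X_{1..m}) (I J : set S).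

Lemma saturated_stableP I : strongly_stable I /\ saturated I <->
  exists2 U, stable U & I = mon_ideal (cyl U).
Proof.
split=> [[/strongly_stableP[W sW ->]]|[U sU ->]].
  move=> /(saturated_monP K sW) cl; exists (slice W); first exact: slice_stable.
  by congr mon_ideal; apply: cyl_slice cl; case: sW.
have sc := cyl_stable sU; split; first by apply/strongly_stableP; exists (cyl U).
apply/saturated_monP => // A.
by rewrite /cyl /= mnmtruncD -(mulm1n U_(ord_max)) mnmtrunc_max addm0.
Qed.

Lemma min_gens_mon (W : set 'X_{1..m.+1}) :
  min_gens (mon_ideal (K := K) W) = minimal W.
Proof.
have WP := mon_idealX K W.
apply/seteqP; split=> A [/WP WA mA]; split; try exact: WA.
- by move=> C WC; apply: mA; apply/mon_idealX.
- by move=> C /mon_idealX; apply: mA.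
Qed.

(** The bound [j < m] in [right_shifts] keeps the last variable out, so the expandability condition
    becomes the adjacent-shift condition of [removal_stable]. *)
Lemma right_shifts_mon U B :
  min_gens (mon_ideal (K := K) (cyl U)) `&` right_shifts (mnmwiden B) = set0 <->
  forall i j : 'I_m, (0 < B i)%N -> j = i.+1 :> nat ->
    ~ minimal U (B - U_(i) + U_(j))%MM.
Proof.
have wE (i j : 'I_m) : mnmwiden (B - U_(i) + U_(j)) =
    (mnmwiden B - U_(widen i) + U_(widen j))%MM.
  rewrite mnmwidenD mnmwiden1; congr (_ + _)%MM.
  apply: mnm_truncP; first by rewrite mnmwidenK mnmtruncB mnmwidenK mnmtrunc1.
  by rewrite mnmwiden_ordmax mnmBE mnmwiden_ordmax.
rewrite min_gens_mon; split=> [h i j Bi ji mD|h].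
  suff : (minimal (cyl U) `&` right_shifts (mnmwiden B)) (mnmwiden (B - U_(i) + U_(j))).
    by rewrite h.
  split; first by apply/minimal_cyl; exists (B - U_(i) + U_(j))%MM.
  by exists (widen i), (widen j); rewrite mnmwiden_widen /=; split.
apply/seteqP; split=> // A [/minimal_cyl[C ->{A} mC] [i [j [Bi ji jm]]]].
have [i' ei] : exists i', i = widen i'.
  by case: (ord_maxP i) => // e; move: ji jm; rewrite e /=; lia.
have [j' ej] : exists j', j = widen j'.
  by case: (ord_maxP j) => // e; move: jm; rewrite e /= ltnn.
rewrite ei ej -wE => /inj_mnmwiden CE; apply: (h i' j').
- by rewrite -mnmwiden_widen -ei.
- by move: ji; rewrite ei ej.
- by rewrite -CE.
Qed.

(* The monomials divisible by x^A x_i with i < max(x^A) are also multiples of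
   x^A x_i / x_r, where r = max(x^A), hence of a generator other than x^A. *)
Lemma upclosure_expansion U B : stable U -> minimal U B -> B <> 0%MM ->
  upclosure ((minimal (cyl U) `\ mnmwiden B) `|`
    [set (mnmwiden B + U_(i))%MM |
       i in [set i : 'I_m.+1 | (max_var (mnmwiden B) <= i < m)%N]]) =
  cyl (U `\ B).
Proof.
move=> sU mB B0; have [up sh] := sU; have [UB mB'] := mB.
have [upc shc] := cyl_stable sU.
have mA : minimal (cyl U) (mnmwiden B) by apply/minimal_cyl; exists B.
apply/seteqP; split=> C; last first.
  rewrite /cyl /= => -[UC nCB].
  have [A mA' AC] := @upset_minimal _ (cyl U) C UC.
  have [e|/eqP ne] := eqVneq A (mnmwiden B); last by exists A => //; left.
  subst A.
  have BC : (B <= mnmtrunc C)%MM by rewrite -lem_widen.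
  have [i hi] := lem_neq BC (fun e => nCB (esym e)).
  have BiC : (mnmwiden B + U_(widen i) <= C)%MM.
    by rewrite -mnmwiden1 -mnmwidenD lem_widen.
  have [h|h] := leqP (max_var (mnmwiden B)) i.
    exists (mnmwiden B + U_(widen i))%MM => //; right; exists (widen i) => //=.
    by rewrite /mkset /= h ltn_ord.
  have [r] : {r : 'I_m.+1 | (0 < mnmwiden B r)%N & max_var (mnmwiden B) = r}.
    apply: eq_bigmax_cond; have [l Bl] := mnm_neq0P B0.
    by apply/card_gt0P; exists (widen l); rewrite unfold_in mnmwiden_widen.
  move=> Br er.
  have [|D mD DA] := @upset_minimal _ (cyl U) (mnmwiden B - U_(r) + U_(widen i))%MM.
    by apply: shc => //; [case: mA | rewrite -er].
  exists D; last first.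
    apply: lepm_trans DA (lepm_trans _ BiC).
    by apply/mnm_lepP => l; rewrite !mnmE; lia.
  left; split=> // DB; move: DA => /mnm_lepP/(_ r).
  rewrite DB !mnmDE mnmBE !mnm1E eqxx.
  have /negbTE -> : widen i != r.
    by apply/eqP => e; move: h; rewrite er -e /= ltnn.
  lia.
case=> A [[/minimal_cyl[D -> {A} [UD mD]] neA]|[i /andP[ri im] <- {A}]].
  rewrite lem_widen => DC; split; first exact: up UD DC.
  by move=> /= CB; apply: neA; rewrite (mB' D) // -CB.
case: (ord_maxP i) => [e|[j ->]]; first by move: im; rewrite e /= ltnn.
rewrite -mnmwiden1 -mnmwidenD lem_widen => BC; split.
  by apply: up UB _; apply: lepm_trans BC; apply: lem_addr.
by move=> /= CB; move: (lem_mdeg BC); rewrite CB mdegD mdeg1; lia.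
Qed.
End SaturatedStable.

(** * Expansions *)

Section Expansions.
Variables (K : fieldType) (m : nat).
Local Notation S := {mpoly K[m.+1]}.
Local Notation widen := (widen_ord (leqnSn m)).
Local Notation ideal U := (mon_ideal (K := K) (cyl U)).
Implicit Types (A : 'X_{1..m.+1}) (B : 'X_{1..m}) (U V W : set 'X_{1..m}) (I J : set S).

Lemma mon_cyl_inj U V : ideal U = ideal V -> U = V.
Proof. by move=> /mon_ideal_inj/cyl_inj. Qed.

(** With this, the separate rule for the unit ideal is also the removal of one monomial. *)
Lemma expansion_one :
  ideal_gen [set 'X_i | i in [set i : 'I_m.+1 | (i < m)%N]] =
  ideal (setT `\ 0%MM).
Proof.
have -> : [set ('X_i : S) | i in [set i : 'I_m.+1 | (i < m)%N]] =
   [set 'X_[A] | A in [set U_(i)%MM | i in [set i : 'I_m.+1 | (i < m)%N]]].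
  by rewrite image_comp.
rewrite ideal_gen_mon; congr mon_ideal; apply/seteqP; split=> C.
  move=> [_ [i im <-]] iC; split=> //= C0.
  case: (ord_maxP i) => [e|[j e]]; first by move: im; rewrite /= e /= ltnn.
  move: iC; rewrite e -mnmwiden1 lem_widen C0 lep1mP.
  by rewrite mnm0E.
move=> [_ /= /mnm_neq0P[j hj]]; exists U_(widen j)%MM; first by exists (widen j) => /=.
by rewrite -mnmwiden1 lem_widen lep1mP -lt0n.
Qed.

Lemma setT_minimal0 n (U : set 'X_{1..n}) : upset U -> U 0%MM -> U = setT.
Proof.
move=> up U0; apply/seteqP; split=> // A _; apply: up U0 _.
by apply/mnm_lepP => i; rewrite mnm0E.
Qed.

Lemma expansionP U A J : stable U ->
  (expansion (ideal U) A J <->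
   exists B, [/\ A = mnmwiden B, U B, stable (U `\ B) & J = ideal (U `\ B)]).
Proof.
move=> sU; have [up sh] := sU; split.
  move eI : (ideal U) => I e; case: I A J / e eI.
    rewrite -mon_idealT -cyl_setT => /mon_cyl_inj ->.
    exists 0%MM; rewrite mnmwiden0 expansion_one; split=> //.
    split=> [B C [_ B0] BC|B i j [_ B0] Bj ij]; split=> // C0; last first.
      by have /mnmP/(_ i) := C0; rewrite !mnmE eqxx; lia.
    apply: B0; rewrite C0 in BC; apply: lem_anti BC _.
    by apply/mnm_lepP => i; rewrite mnm0E.
  move=> I A _ _ nT [A0 [mA nR]] eI; rewrite -eI in mA nR *.
  move: mA; rewrite min_gens_mon => /minimal_cyl[B e mB]; rewrite e in A0 nR *.
  exists B; split=> //; first by case: mB.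
    apply/removal_stable => //; first by case: mB.
    by split=> //; apply/(right_shifts_mon K).
  rewrite ideal_gen_mon upclosure_expansion //.
  by move=> B0; apply: A0; rewrite B0 mnmwiden0.
move=> [B [-> UB sB ->]].
have [mB nR] := (removal_stable sU UB).1 sB.
have [B0|/eqP B0] := eqVneq B 0%MM.
  rewrite B0 in UB *; have -> := setT_minimal0 up UB.
  by rewrite -expansion_one mnmwiden0 cyl_setT mon_idealT; apply: ExpansionOne.
have [ssU satU] : strongly_stable (ideal U) /\ saturated (ideal U).
  by apply/saturated_stableP; exists U.
rewrite -(upclosure_expansion sU mB B0) -ideal_gen_mon -(min_gens_mon K).
apply: ExpansionProper => //.
  rewrite -mon_idealT -cyl_setT => /mon_cyl_inj UT; apply: B0.
  have U0 : U 0%MM by rewrite UT.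
  by apply: esym; apply: mB.2 => //; apply/mnm_lepP => i; rewrite mnm0E.
split; first by rewrite -mnmwiden0 => /inj_mnmwiden.
split; last exact/right_shifts_mon.
by rewrite min_gens_mon; apply/minimal_cyl; exists B.
Qed.

Lemma successive_expansionsP V a J : stable V ->
  (successive_expansions a (ideal V) J <->
   exists U (s : seq 'X_{1..m}), [/\ stable U, U `<=` V, uniq s /\ size s = a,
     [set` s] = V `\` U & J = ideal U]).
Proof.
move=> sV; elim: a J => [|a IH] J.
  split=> [->|[U [s [_ UV [_ /size0nil ->] sE ->]]]].
    exists V, [::]; split=> //; rewrite setDv; apply/seteqP; by split=> x.
  suff -> : V = U by [].
  apply/seteqP; split=> // A VA; apply: contrapT => nUA.
  by have : [set` Nil 'X_{1..m}] A by rewrite sE.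
split.
  move=> [I [A [/IH[U [s [sU UV [us <-] sE ->]]] /(expansionP _ _ sU)]]].
  move=> [B [_ UB sB ->]].
  have memE C : C \in s <-> V C /\ ~ U C.
    by have := congr1 (fun X => X C) sE; rewrite /setD /mkset /= => ->.
  exists (U `\ B), (B :: s); split=> //.
  - by move=> C [/UV].
  - split=> //=; rewrite us andbT; apply/negP => /memE[_]; exact.
  - apply/seteqP; split=> C; rewrite /mkset inE.
      move=> /orP[/eqP ->|/memE[VC nUC]]; first by split; [apply: UV|move=> [_]; apply].
      by split=> // -[].
    move=> [VC nC]; have [->|/eqP ne] := eqVneq C B; first by [].
    by apply/memE; split=> // UC; apply: nC.
move=> [U [s [sU UV [us hs] sE ->]]].
have memE C : C \in s <-> V C /\ ~ U C.
  by have := congr1 (fun X => X C) sE; rewrite /setD /mkset /= => ->.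
(* The monomial that can be put back first is the one that is removed last. *)
have [B Bs sB] : exists2 B, B \in s & stable (B |` U).
  by apply: stable_add sE => //; move=> s0; rewrite s0 in hs.
have [VB nUB] := (memE B).1 Bs.
exists (ideal (B |` U)), (mnmwiden B); split.
  apply/IH; exists (B |` U), (rem B s); split=> //.
  - by move=> C [->|/UV].
  - by rewrite rem_uniq // size_rem // hs.
  - apply/seteqP; split=> C; rewrite /mkset mem_rem_uniq // inE.
      by move=> /andP[/eqP CB /memE[VC nUC]]; split=> // -[].
    move=> [VC nC]; apply/andP; split.
      by apply/eqP => e; apply: nC; left.
    by apply/memE; split=> // UC; apply: nC; right.
have UE : (B |` U) `\ B = U.
  apply/seteqP; split=> C; first by case=> -[].
  by move=> UC; split; [right|move=> e; apply: nUB; rewrite -e].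
by apply/expansionP => //; exists B; split=> //; rewrite ?UE //; left.
Qed.

Lemma finite_expansion_choices U : stable U ->
  finite_set [set A | exists J, expansion (ideal U) A J].
Proof.
move=> sU; apply: sub_finite_set (finite_minimal (cyl_upset sU.1)).
move=> A [J /(expansionP _ _ sU)[B [-> UB sB _]]].
apply/minimal_cyl; exists B => //.
by have [] := (removal_stable sU UB).1 sB.
Qed.

Lemma finitely_many_choices_mon V a : stable V -> finitely_many_choices a (ideal V).
Proof.
move=> sV b J _ /(successive_expansionsP _ _ sV)[U [s [sU _ _ _ ->]]].
exact: finite_expansion_choices.
Qed.

Lemma finite_successive_expansions V a :
  stable V -> finite_set (successive_expansions a (ideal V)).
Proof.
move=> sV; elim: a => [|a IH]; first exact: finite_set1.
have -> : successive_expansions a.+1 (ideal V) =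
    \bigcup_(I in successive_expansions a (ideal V))
      [set J | exists A, expansion I A J].
  apply/seteqP; split=> J; first by move=> [I [A [hI hJ]]]; exists I => //; exists A.
  by move=> [I hI [A hJ]]; exists I, A.
apply: bigcup_finite => // I /(successive_expansionsP _ _ sV)[U [_ [sU _ _ _ ->]]].
(* The chosen monomial determines the expansion, so finitely many choices give finitely many
   results. *)
pose f (A : 'X_{1..m.+1}) : set S := ideal (U `\ mnmtrunc A).
apply: sub_finite_set (finite_image f (finite_expansion_choices sU)).
move=> J [A hA]; exists A; first by exists J.
by have [B [-> _ _ ->]] := (expansionP _ _ sU).1 hA; rewrite /f mnmwidenK.
Qed.

End Expansions.

(** * The procedure *)

Section HilbertPolynomialCriterion.
Variables (K : fieldType) (m : nat).
Local Notation S := {mpoly K[m.+1]}.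
Local Notation ideal U := (mon_ideal (K := K) (cyl U)).
Implicit Types (q : {poly rat}).

Lemma hilbert_polynomialP (U : set 'X_{1..m.+1}) q :
  hilbert_polynomial (mon_ideal (K := K) U) q <->
  exists N, forall k, (N <= k)%N -> q.[k%:R] = (cocount U k)%:R.
Proof.
split=> -[N hN]; exists N => k /hN; first by case=> h /hilbert_functionP ->.
by move=> e; exists (cocount U k) => //; apply/hilbert_functionP.
Qed.

End HilbertPolynomialCriterion.

Section StableIdealHilbertPolynomials.
Variables (K : fieldType) (m : nat).
Local Notation S := {mpoly K[m.+1]}.
Local Notation ideal U := (mon_ideal (K := K) (cyl U)).
Implicit Types (q : {poly rat}) (I : set S).

Lemma hilbert_polynomial_uniq (U : set 'X_{1..m.+1}) q q' :
  hilbert_polynomial (mon_ideal (K := K) U) q ->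
  hilbert_polynomial (mon_ideal (K := K) U) q' -> q = q'.
Proof.
move=> /hilbert_polynomialP[N hN] /hilbert_polynomialP[N' hN'].
apply: poly_large_eq; exists (N + N')%N => k hk.
by rewrite hN ?hN' //; lia.
Qed.

Lemma hilbert_polynomial_sub (U V : set 'X_{1..m}) (s : seq 'X_{1..m}) q q' :
  U `<=` V -> uniq s -> [set` s] = V `\` U -> q = q' + ((size s)%:R)%:P ->
  (hilbert_polynomial (ideal U) q <-> hilbert_polynomial (ideal V) q').
Proof.
move=> UV us sE ->; have [N hN] := cocount_cyl_sub_large UV us sE.
split=> /hilbert_polynomialP[N' hN']; apply/hilbert_polynomialP;
  exists (N + N')%N => k hk; have hk1 : (N <= k)%N by lia.
  have := hN' k; rewrite hornerD hornerC hN // natrD => /(_ _)/addIr; apply; lia.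
by rewrite hornerD hornerC hN // natrD hN' //; lia.
Qed.

Lemma hilbert_polynomial_cyl (U : set 'X_{1..m.+1}) q :
  hilbert_polynomial (mon_ideal (K := K) (cyl U)) q ->
  hilbert_polynomial (mon_ideal (K := K) U) (backward_diff q).
Proof.
move=> /hilbert_polynomialP[N hN]; apply/hilbert_polynomialP.
exists N.+1 => -[//|k] hk; rewrite horner_backward_diff -natr1 addrK natr1.
rewrite !hN ?cocount_cyl ?natrD //; last by lia.
by rewrite addrC addKr.
Qed.

Definition ss_ideals q : set (set S) :=
  [set I | [/\ strongly_stable I, saturated I & hilbert_polynomial I q]].

Lemma ss_idealsP q I : ss_ideals q I <->
  exists U, [/\ stable U, I = ideal U & hilbert_polynomial (ideal U) q].
Proof.
split=> [[ssI satI hI]|[U [sU -> hU]]].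
  by have [U sU eI] := (saturated_stableP I).1 (conj ssI satI); exists U; rewrite -eI.
by have [] := (saturated_stableP (ideal U)).2 (ex_intro2 _ _ U sU erefl).
Qed.

Lemma hilbert_polynomial_setT : hilbert_polynomial (ideal [set: 'X_{1..m}]) 0.
Proof.
by apply/hilbert_polynomialP; exists 0%N => k _; rewrite horner0 cyl_setT cocount_setT.
Qed.

Lemma successive_expansions_one c :
  successive_expansions c [set: S] = ss_ideals (c%:R)%:P.
Proof.
have sT := @stable_setT m.
have -> : [set: S] = ideal setT by rewrite cyl_setT mon_idealT.
apply/seteqP; split=> I.
  move=> /(successive_expansionsP _ _ sT)[U [s [sU UT [us <-] sE ->]]].
  apply/ss_idealsP; exists U; split=> //.
  apply/(hilbert_polynomial_sub UT us sE (esym (add0r _))).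
  exact: hilbert_polynomial_setT.
move=> /ss_idealsP[U [sU -> hU]]; apply/(successive_expansionsP _ _ sT).
(* A constant Hilbert polynomial forces the difference [cocount U] to vanish in large degrees, so
   every monomial outside [U] has degree at most [N]. *)
have [s us sE] : exists2 s : seq 'X_{1..m}, uniq s & [set` s] = setT `\` U.
  apply: finite_uniq_enum; have /hilbert_polynomialP[N hN] := hU.
  apply: sub_finite_set (finite_mdeg_le _ N) => A [_ nUA] /=.
  rewrite leqNgt; apply/negP => hA; case E : (mdeg A) hA => [//|k] hk.
  have := hN k.+1 (ltnW hk); rewrite cocount_cyl natrD -hN // !hornerC.
  move/eqP; rewrite -{1}[c%:R]addr0 eq_sym (inj_eq (addrI _)) pnatr_eq0.
  rewrite -leqn0 leqNgt -has_count => /negP; apply; apply/hasP; exists A.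
    by rewrite mem_monomials E.
  exact/asboolP.
exists U, s; split=> //; split=> //.
(* Comparison with the Hilbert polynomial 0 of the zero ring gives [size s = c]. *)
have e : (c%:R)%:P = ((c%:R)%:P - ((size s)%:R)%:P) + ((size s)%:R)%:P :> {poly rat}.
  by rewrite subrK.
have := (hilbert_polynomial_sub (subsetT U) us sE e).1 hU.
move=> /hilbert_polynomial_uniq/(_ hilbert_polynomial_setT)/eqP.
by rewrite subr_eq0 => /eqP/polyC_inj/eqP; rewrite eqr_nat => /eqP.
Qed.

End StableIdealHilbertPolynomials.

(** * One pass of the loop *)

Section Lifting.
Variables (K : fieldType) (m : nat) (p : {poly rat}) (j : nat).
Local Notation ideal U := (mon_ideal (K := K) (cyl U)).
Implicit Types (U V : set 'X_{1..m}) (I : set {mpoly K[m.+1]}).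

Lemma discrepancy_mon (W : set 'X_{1..m.+2}) a :
  discrepancy p j (mon_ideal (K := K) W) a <->
  hilbert_polynomial (mon_ideal (K := K) W) (Delta j p - (a%:~R)%:P).
Proof.
split=> [[q hq <-]|h]; first by rewrite subKr.
by exists (Delta j p - (a%:~R)%:P) => //; rewrite subKr.
Qed.

Lemma discrepancy_uniq (W : set 'X_{1..m.+2}) a b :
  discrepancy p j (mon_ideal (K := K) W) a ->
  discrepancy p j (mon_ideal (K := K) W) b -> a = b.
Proof.
move=> /discrepancy_mon ha /discrepancy_mon hb.
have /addrI/oppr_inj/polyC_inj/eqP := hilbert_polynomial_uniq ha hb.
by rewrite eqr_int => /eqP.
Qed.

Lemma lift_and_expand_ss_ideals :
  lift_and_expand p j (@ss_ideals K m (Delta j.+1 p)) = @ss_ideals K m.+1 (Delta j p).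
Proof.
apply/seteqP; split=> J.
  move=> [I [a [/ss_idealsP[U [sU -> _]]]]].
  have sc := cyl_stable sU; rewrite (extend_mon K sc.1).
  move=> /discrepancy_mon hd /(successive_expansionsP _ _ sc).
  move=> [W [s [sW WU [us sa] sE ->]]]; apply/ss_idealsP; exists W; split=> //.
  have e : Delta j p = (Delta j p - (a%:~R)%:P) + ((size s)%:R)%:P.
    by rewrite sa subrK.
  exact: (hilbert_polynomial_sub K WU us sE e).2.
move=> /ss_idealsP[W [sW -> hW]].
pose U := last_sat W; have sU : stable U := last_sat_stable sW.
have sc := cyl_stable sU; have WU : W `<=` cyl U := sub_last_sat sW.1.
have [s us sE] := finite_uniq_enum (finite_last_sat sW).
exists (ideal U), (size s); split.
- apply/ss_idealsP; exists U; split=> //.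
  (* The first difference of [Delta j p] belongs to [W]; it also belongs to [cyl U], since the two
     sets agree in large degrees. *)
  have /hilbert_polynomialP[N hN] := hilbert_polynomial_cyl hW.
  have [N' hN'] := cocount_sub_large WU us sE.
  apply/hilbert_polynomialP; exists (N + N')%N => k hk.
  by rewrite -hN' ?hN //; lia.
- rewrite (extend_mon K sc.1); apply/discrepancy_mon.
  have e : Delta j p = (Delta j p - ((size s)%:R)%:P) + ((size s)%:R)%:P.
    by rewrite subrK.
  exact: (hilbert_polynomial_sub K WU us sE e).1.
- rewrite (extend_mon K sc.1); apply/(successive_expansionsP _ _ sc).
  by exists W, s; split.
Qed.

(** [Delta j p] and the Hilbert function of the extended quotient eventually have the same first
    differences, so they differ by a constant, which is an integer because both take integer values
    in large degrees. *)
Lemma discrepancy_exists I :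
  (exists N, forall k : nat, (N <= k)%N -> (Delta j p).[k%:R] \is a Num.int) ->
  ss_ideals (Delta j.+1 p) I -> exists a, discrepancy p j (extend I) a.
Proof.
move=> [N1 h1] /ss_idealsP[U [sU -> /hilbert_polynomialP[N2 h2]]].
have sc := cyl_stable sU; rewrite (extend_mon K sc.1).
pose N := (N1 + N2)%N.
pose f k : rat := (Delta j p).[k%:R] - (cocount (cyl (cyl U)) k)%:R.
have fN k : (N <= k)%N -> f k = f N.
  move=> /subnKC <-; elim: (k - N)%N => [|l IH]; first by rewrite addn0.
  rewrite -IH addnS; have := h2 (N + l).+1; rewrite DeltaS horner_backward_diff.
  rewrite -natr1 addrK natr1 => /(_ _)/= h.
  have /h/eqP : (N2 <= (N + l).+1)%N by rewrite /N; lia.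
  rewrite /f (cocount_cyl (cyl U)) (natrD _ (cocount _ _)) subr_eq => /eqP ->.
  by ring.
have /intrP[a fa] : f N \is a Num.int.
  by rewrite rpredB ?rpred_nat // h1 // /N leq_addr.
exists a; apply/discrepancy_mon/hilbert_polynomialP; exists N => k /fN.
by rewrite fa hornerD hornerN hornerC /f => <-; ring.
Qed.

Lemma finite_lift_and_expand (T : set (set {mpoly K[m.+1]})) :
  finite_set T -> T `<=` ss_ideals (Delta j.+1 p) ->
  finite_set (lift_and_expand p j T).
Proof.
move=> fT hT.
have -> : lift_and_expand p j T = \bigcup_(I in T)
    [set J | exists2 a : nat, discrepancy p j (extend I) a
                            & successive_expansions a (extend I) J].
  apply/seteqP; split=> J; first by move=> [I [a [TI ha hJ]]]; exists I => //; exists a.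
  by move=> [I TI [a ha hJ]]; exists I, a.
apply: bigcup_finite => // I /hT/ss_idealsP[U [sU -> _]].
have sc := cyl_stable sU; rewrite (extend_mon K sc.1).
(* At most one [a] is possible for each ideal; if the discrepancy is negative, the ideal contributes
   nothing. *)
have [[a ha]|na] := pselect (exists a : nat, discrepancy p j (ideal (cyl U)) a).
  apply: sub_finite_set (finite_successive_expansions K a sc) => J [b hb].
  by have [->] := discrepancy_uniq hb ha.
rewrite [X in finite_set X](_ : _ = set0) //; apply/seteqP; split=> // J [a ha _].
by apply: na; exists a.
Qed.

End Lifting.

(** * Termination and correctness *)

Section Correctness.
Variables (K : fieldType) (n d : nat) (p : {poly rat}).

Lemma computes_ss_ideals j m (T : set (set {mpoly K[m.+1]})) :
  computes n d p j T -> (m + j)%N = n /\ T = ss_ideals (Delta j p).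
Proof.
elim=> {j m T} [m c mn cE _ _|j m T _ [mn ->] _ _].
  by rewrite successive_expansions_one cE.
by rewrite lift_and_expand_ss_ideals; split=> //; lia.
Qed.

Lemma computes_exists (c : nat) :
  (d <= n)%N -> Delta d p = (c%:R)%:P ->
  (exists N, forall k : nat, (N <= k)%N -> p.[k%:R] \is a Num.int) ->
  forall i j m, (j + i)%N = d -> (m + j)%N = n ->
  exists2 T : set (set {mpoly K[m.+1]}), computes n d p j T & finite_set T.
Proof.
move=> dn cE pint; elim=> [|i IH] j m.
  rewrite addn0 => -> mn; exists (successive_expansions c [set: {mpoly K[m.+1]}]).
    apply: ComputesTop => //; rewrite -mon_idealT -cyl_setT.
      exact: finitely_many_choices_mon.
    exact: finite_successive_expansions.
  by rewrite -mon_idealT -cyl_setT; apply: finite_successive_expansions.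
(* Here [j < d <= n], so [m = n - j] is positive and there is a variable to drop. *)
case: m => [|m] ji mj; first by lia.
have [||T cT fT] := IH j.+1 m; [by lia|by lia|].
have [_ TE] := computes_ss_ideals cT.
have fL : finite_set (lift_and_expand p j T).
  by apply: finite_lift_and_expand fT _; rewrite TE.
exists (lift_and_expand p j T) => //; apply: ComputesNext => // I.
rewrite TE => hI.
have [a ha] := discrepancy_exists (Delta_int j pint) hI.
exists a => // b _; have [U [sU -> _]] := (ss_idealsP _ _).1 hI.
have sc := cyl_stable sU; rewrite (extend_mon K sc.1).
exact: finitely_many_choices_mon.
Qed.

End Correctness.

(** * Sign of the leading difference and bound on the degree *)

Lemma bin_le_exp k n : ('C(k + n, k) <= k.+1 ^ n)%N.
Proof.
rewrite -(bin_sub (leq_addr n k)) addKn.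
elim: n => [|n IH]; first by rewrite bin0.
(* Raising [n] by one multiplies the binomial by [(k + n + 1) / (n + 1)], which is at most
   [k + 1]. *)
have := mul_bin_diag (k + n.+1) n; rewrite addnS /= => e.
rewrite -(leq_pmul2l (ltn0Sn n)) -e expnS.
apply: leq_trans (leq_mul (leqnn _) IH) _.
by rewrite !mulnA leq_mul2r; apply/orP; right; nia.
Qed.

Section DegreeBound.
Variables (K : fieldType) (n : nat) (J : set {mpoly K[n.+1]}) (p : {poly rat}) (d : nat).
Hypotheses (hJ : hilbert_polynomial J p) (hd : size p = d.+1).

Lemma hilbert_polynomial_bounds : exists N, forall k : nat, (N <= k)%N ->
  exists2 h : nat, p.[k%:R] = h%:R & (h <= k.+1 ^ n)%N.
Proof.
have [N hN] := hJ; exists N => k /hN[h [V [_ hV]] ->]; exists h => //.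
apply: leq_trans (bin_le_exp k n); rewrite dimvf /dim /= in hV.
by rewrite -hV leq_addr.
Qed.

(** The [d]-th difference is a nonzero constant by degree and an integer because [p] takes integer
    values in large degrees. Were it negative, [p] would eventually be negative, contrary to its
    values being dimensions. *)
Lemma Delta_lead : exists2 c : nat, (0 < c)%N & Delta d p = (c%:R)%:P.
Proof.
have [N hN] := hilbert_polynomial_bounds.
have sz : size (Delta d p) = 1 by rewrite size_Delta hd subSnn.
have [c c0 cE] : exists2 c, c != 0 & Delta d p = c%:P by apply/size_poly1P/eqP.
have [|N' hN'] := @Delta_int d p.
  by exists N => k /hN[h -> _]; apply: rpred_nat.
have /intrP[a ca] : c \is a Num.int by have := hN' N' (leqnn _); rewrite cE hornerC.
have a0 : a != 0 by apply: contraNneq c0 => a0; rewrite ca a0.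
case: a ca a0 => [a|a] ca a0.
  by exists a; rewrite ?lt0n // cE ca.
have [|N2 h2] := @Delta_neg d p.
  exists 0%N => k _; rewrite cE hornerC ca NegzE mulrNz lerN2 -[1]/(1%:R).
  by rewrite -pmulrn ler_nat.
have [h eh _] := hN (N + N2)%N (leq_addr _ _).
have := h2 (N + N2)%N (leq_addl _ _); rewrite eh => h'.
have : 0 <= h%:R :> rat by apply: ler0n.
lra.
Qed.

(** The values of [p] are eventually at most those of [g = (X + 1)^n]. If [d] exceeded [n], the
    [d]-th difference would kill [g], so that of [g - p] would be the negative constant [-c], and
    [p] would eventually overtake [g]. *)
Lemma degree_le : (d <= n)%N.
Proof.
rewrite leqNgt; apply/negP => nd; have [N hN] := hilbert_polynomial_bounds.
have [c c0 cE] := Delta_lead.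
pose g : {poly rat} := ('X + 1%:P) ^+ n.
have sg : size g = n.+1 by rewrite -(@size_exp_XsubC rat n (-1)) polyCN opprK.
have gE : Delta d (g - p) = - (c%:R)%:P.
  rewrite DeltaB cE; have /eqP : size (Delta d g) == 0 by rewrite size_Delta sg; lia.
  by move/eqP; rewrite size_poly_eq0 => /eqP ->; rewrite sub0r.
have [|N2 h2] := @Delta_neg d (g - p).
  by exists 0%N => k _; rewrite gE hornerN hornerC lerN2 -[1]/(1%:R) ler_nat.
have [h eh hb] := hN (N + N2)%N (leq_addr _ _).
have := h2 (N + N2)%N (leq_addl _ _); rewrite hornerD hornerN eh.
rewrite horner_exp hornerD hornerX hornerC natr1 -natrX => h'.
have : h%:R <= ((N + N2).+1 ^ n)%:R :> rat by rewrite ler_nat.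
lra.
Qed.
End DegreeBound.

Unset Implicit Arguments.

Theorem mainTheorem2 (K : fieldType) (n : nat) (hn : (2 <= n)%N)
    (p : {poly rat}) (d : nat)
    (hp : exists J : set {mpoly K[n.+1]},
        homogeneous_ideal J /\ hilbert_polynomial J p)
    (hp0 : p <> 0) (hd : size p = d.+1) :
  (exists T : set (set {mpoly K[n.+1]}), returns d p T) /\
  (forall T : set (set {mpoly K[n.+1]}), returns d p T ->
     forall I : set {mpoly K[n.+1]},
       T I <-> [/\ strongly_stable I, saturated I & hilbert_polynomial I p]).
Proof.
have [J [_ hJ]] := hp; split; last first.
  by move=> T hT I; have [_ ->] := computes_ss_ideals hT.
have [c _ cE] := Delta_lead hJ hd.
have [N hN] := hilbert_polynomial_bounds hJ.
(* All [d] passes of the loop, from level [d] down to level 0. *)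
have [|||T hT _] := @computes_exists K n d p c (degree_le hJ hd) cE _ d 0 n.
- by exists N => k /hN[h -> _]; apply: rpred_nat.
- by [].
- by rewrite addn0.
by exists T.
Qed.
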